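(* Let $n\ge2$, let $[n]=D\sqcup U$ be a partition as in the context, and let $$\tilde P=\Big\{x\in\mathbb R^n:\ \sum_{i\in[n]}x_i=\tilde z_{[n]},\ \ \sum_{i\in R_\delta}x_i\ge\tilde z_{R_\delta}\text{ for all proper diagonals }\delta\Big\}$$ be a polytope with the same normal fan as the associahedron $\mathsf{As}_{n-1}^{D,U}$ (so these inequalities are precisely the facet-defining ones). For every non-empty $I\subseteq[n]$ with nested components of types $(1,w_1),\dots,(1,w_v)$ and associated diagonals $\delta_{i,j}$ ($1\le i\le v$, $1\le j\le w_i+1$), set $$z_I:=\sum_{i=1}^v\Big(\sum_{j=1}^{w_i+1}\tilde z_{R_{\delta_{i,j}}}-w_i\,\tilde z_{[n]}\Big).$$ Then $\tilde P=\{x\in\mathbb R^n:\sum_{i\in[n]}x_i=z_{[n]},\ \sum_{i\in I}x_i\ge z_I\text{ for all }\varnothing\ne I\subsetneq[n]\}$, and all $z_I$ are tight, i.e. $z_I=\min_{x\in\tilde P}\sum_{i\in I}x_i$ for every non-empty $I\subseteq[n]$.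
   Context: Partition and polygon. $[n]=\{1,\dots,n\}=D\sqcup U$ with $D=\{d_1=1<d_2<\dots<d_\ell=n\}$ ($\ell\ge2$) and $U=\{u_1<\dots<u_m\}$ ($m\ge0$). Put $\overline D=D\cup\{0,n+1\}$. $Q$ is a convex $(n+2)$-gon whose vertices are labelled, in counter-clockwise cyclic order, $0,d_1,\dots,d_\ell,n+1,u_m,\dots,u_1$. A diagonal is a pair $\{x,y\}$ of distinct labels; it is proper if $x,y$ are not adjacent on the boundary of $Q$. Sets $R_\delta$. For $\delta=\{x,y\}$, $x<y$: $R_\delta=\{d\in D: x<d<y\}$ if $x,y\in\overline D$; $R_\delta=\{d\in D:d>x\}\cup\{u\in U:u\ge y\}$ if $x\in\overline D,\ y\in U$; $R_\delta=\{d\in D:d<y\}\cup\{u\in U:u\le x\}$ if $x\in U,\ y\in\overline D$; $R_\delta=D\cup\{u\in U:u\le x\}\cup\{u\in U:u\ge y\}$ if $x,y\in U$. In particular for the non-proper diagonals $\{0,u_1\}$ and $\{u_m,n+1\}$ one has $R_\delta=[n]$, as well as $R_{\{0,n+1\}}=[n]$ if $U=\varnothing$. Decomposition. $(a,b)_D=\{d\in D:a<d<b\}$ and, for $\alpha\le\beta$ in $U$, $[\alpha,\beta]_U=\{u\in U:\alpha\le u\le\beta\}$. For non-empty $I\subseteq[n]$ write $\overline D\setminus I=\{e_0=0<e_1<\dots<e_k=n+1\}$. The nested components $I_1,\dots,I_v$ of $I$ (in increasing order) are the non-empty sets among $I\cap(e_{r-1},e_r)$, $1\le r\le k$; if $I_i=I\cap(e_{r-1},e_r)$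 put $a_i=e_{r-1}$, $b_i=e_r$. Let $[\alpha_{i,j},\beta_{i,j}]_U$, $1\le j\le w_i$, with $\beta_{i,j}<\alpha_{i,j+1}$, be the inclusion-maximal sets of the form $[\alpha,\beta]_U$ contained in $I_i$; then $I_i=(a_i,b_i)_D\sqcup\bigsqcup_{j}[\alpha_{i,j},\beta_{i,j}]_U$, and $I_i$ is said to have type $(1,w_i)$. Associated diagonals. If $w_i=0$: $\delta_{i,1}=\{a_i,b_i\}$. If $w_i>0$: $\delta_{i,1}=\{a_i,\alpha_{i,1}\}$, $\delta_{i,j}=\{\beta_{i,j-1},\alpha_{i,j}\}$ for $1<j\le w_i$, and $\delta_{i,w_i+1}=\{\beta_{i,w_i},b_i\}$. Polytope. $\mathsf{As}_{n-1}^{D,U}=\{x\in\mathbb R^n:\sum_{i\in[n]}x_i=\tfrac{n(n+1)}2,\ \sum_{i\in R_\delta}x_i\ge\tfrac{|R_\delta|(|R_\delta|+1)}2\text{ for all proper diagonals }\delta\}$, an $(n-1)$-dimensional associahedron. *)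

(* Defs.v *)
From mathcomp Require Import classical_sets reals.
From mathcomp Require Import all_boot all_order all_algebra.

Set Implicit Arguments.
Unset Strict Implicit.
Unset Printing Implicit Defensive.

Import Order.TTheory GRing.Theory Num.Theory.
Local Open Scope ring_scope.

(* The element k of [n] = {1, ..., n} is represented by the ordinal k.-1 of
   'I_n, and a label 0, ..., n+1 of the polygon by an ordinal of 'I_n.+2.
   The partition [n] = D + U is given by D alone, with U = ~: D. *)

Section Combinatorics.

Variable n : nat.

(* vtx i has value i.+1: it is the label of the element that i represents. *)
Definition vtx (i : 'I_n) : 'I_n.+2 := lift ord0 (widen_ord (leqnSn n) i).

Definition polygon_diagonal : Type := ('I_n.+2 * 'I_n.+2)%type.

Variable D : {set 'I_n}.

Definition Dbar : {set 'I_n.+2} := ord0 |: (ord_max |: (vtx @: D)).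

(* Enumerations of ordinals are increasing, so this is
   0, d_1, ..., d_l, n+1, u_m, ..., u_1. *)
Definition polygon : seq 'I_n.+2 :=
  (ord0 :: [seq vtx d | d <- enum D])
    ++ (ord_max :: rev [seq vtx u | u <- enum (~: D)]).

Definition adjacent (x y : 'I_n.+2) : bool :=
  (next polygon x == y) || (next polygon y == x).

(* A diagonal {x, y} is represented by the pair of its ends with x < y. *)
Definition proper_diagonal (delta : polygon_diagonal) : bool :=
  (delta.1 < delta.2)%N && ~~ adjacent delta.1 delta.2.

Definition Rset (delta : polygon_diagonal) : {set 'I_n} :=
  let: (x, y) := delta in
  match x \in Dbar, y \in Dbar with
  | true, true => [set d in D | x < vtx d < y]%N
  | true, false => [set d in D | x < vtx d]%N :|: [set u in ~: D | y <= vtx u]%N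
  | false, true => [set d in D | vtx d < y]%N :|: [set u in ~: D | vtx u <= x]%N
  | false, false =>
      D :|: [set u in ~: D | vtx u <= x]%N :|: [set u in ~: D | y <= vtx u]%N
  end.

Definition Uint (alpha beta : 'I_n) : {set 'I_n} :=
  [set u in ~: D | alpha <= u <= beta]%N.

Definition is_Uint (S : {set 'I_n}) : bool :=
  [exists alpha in ~: D, exists beta in ~: D,
     (alpha <= beta)%N && (S == Uint alpha beta)].

(* A nested component is given by its ends (a_i, b_i) = (e_{r-1}, e_r). *)
Definition component (I : {set 'I_n}) (ab : 'I_n.+2 * 'I_n.+2) : {set 'I_n} :=
  [set i in I | ab.1 < vtx i < ab.2]%N.

Definition components (I : {set 'I_n}) : seq ('I_n.+2 * 'I_n.+2) :=
  let e := enum (Dbar :\: vtx @: I) in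
  [seq ab <- zip e (behead e) | component I ab != set0].

(* The pairs (alpha_j, beta_j), in increasing order, since the list of all
   pairs is in row-major order and a maximal interval is determined by its
   left end. *)
Definition max_Uints (J : {set 'I_n}) : seq ('I_n * 'I_n) :=
  [seq ab : 'I_n * 'I_n <- [seq (alpha, beta) | alpha <- enum (~: D), beta <- enum (~: D)]
     | (ab.1 <= ab.2)%N &&
       maxset [pred S | is_Uint S & S \subset J] (Uint ab.1 ab.2)].

(* The number w of the type (1, w) of a component. *)
Definition wtype (I : {set 'I_n}) (ab : 'I_n.+2 * 'I_n.+2) : nat :=
  size (max_Uints (component I ab)).

(* Pairs a, beta_1, ..., beta_w with alpha_1, ..., alpha_w, b; this is [:: (a, b)]
   if w = 0. *)
Definition assoc_diagonals (I : {set 'I_n}) (ab : 'I_n.+2 * 'I_n.+2) :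
    seq polygon_diagonal :=
  let s := max_Uints (component I ab) in
  zip (ab.1 :: [seq vtx p.2 | p <- s]) (rcons [seq vtx p.1 | p <- s] ab.2).

End Combinatorics.

Section Geometry.

Variables (R : realType) (n : nat).
Implicit Types (P F : set 'rV[R]_n) (c x : 'rV[R]_n).

Definition coord_sum (I : {set 'I_n}) x : R := \sum_(i in I) x 0 i.

Definition convex_hull k (v : 'I_k -> 'rV[R]_n) : set 'rV[R]_n :=
  [set x | exists t : 'I_k -> R,
     [/\ forall i, 0 <= t i, \sum_i t i = 1 & x = \sum_i t i *: v i]]%classic.

Definition polytope P : Prop :=
  exists k (v : 'I_k -> 'rV[R]_n), P = convex_hull v.

Definition dot c x : R := \sum_i c 0 i * x 0 i.

Definition argmax c P : set 'rV[R]_n :=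
  [set x | P x /\ forall y, P y -> dot c y <= dot c x]%classic.

Definition nonempty_face P F : Prop :=
  (F !=set0)%classic /\ exists c, F = argmax c P.

Definition normal_cone P F : set 'rV[R]_n :=
  [set c | F `<=` argmax c P]%classic.

Definition normal_fan P : set (set 'rV[R]_n) :=
  [set N | exists2 F, nonempty_face P F & N = normal_cone P F]%classic.

Variable D : {set 'I_n}.

Definition diagonal_polyhedron (z : {set 'I_n} -> R) : set 'rV[R]_n :=
  [set x | coord_sum setT x = z setT /\
     forall delta, proper_diagonal D delta ->
       z (Rset D delta) <= coord_sum (Rset D delta) x]%classic.

Definition associahedron : set 'rV[R]_n :=
  diagonal_polyhedron (fun S => (#|S| * #|S|.+1)%N%:R / 2).

Definition zI (z : {set 'I_n} -> R) (I : {set 'I_n}) : R :=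
  \sum_(ab <- components D I)
    (\sum_(delta <- assoc_diagonals D I ab) z (Rset D delta)
       - (wtype D I ab)%:R * z setT).

Definition is_minimum (A : set R) (m : R) : Prop := A m /\ lbound A m.

End Geometry.

(* Main.v *)
Require Import Defs.
From mathcomp Require Import boolp classical_sets reals.
From mathcomp Require Import all_boot all_order all_algebra.
From mathcomp Require Import zify ring lra.

Set Implicit Arguments.
Unset Strict Implicit.
Unset Printing Implicit Defensive.

Import Order.TTheory GRing.Theory Num.Theory.
Local Open Scope ring_scope.

(* As indicator functions, the sets R_delta of the diagonals associated with I
   sum to 1_I up to a multiple of 1_[n]. Each of these diagonals is proper or
   has R_delta = [n], so z_I is a lower bound on the polytope, attained exactly
   where all associated facet inequalities are tight.

   For the associahedron itself such a point is found greedily. Sweeping the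
   polygon by x-monotone paths from 0 to n+1, let eta(A) be minus one half of
   the sum of c (n - c), c = |R_delta|, over the edges delta of the path
   obtained from the lower boundary by deleting the vertices of A in D and
   inserting those in U. Then eta is supermodular, vanishes at the empty set and
   at [n], and eta(R_delta) >= - c (n - c) / 2; hence the greedy algorithm along
   a chain through I yields a point which, translated by (n+1)/2 in each
   coordinate, lies in the associahedron and is tight on all edges of the path
   of I, among them the associated diagonals.

   Tightness is carried over to the polytope by the normal fan. The centre of
   the face R_delta of the permutahedron is tight for no other facet inequality
   of the associahedron, so that the ray of -1_{R_delta} is a cone of the fan;
   a perturbation argument then shows that the inequality of delta is attained
   on the polytope. The normal cone of the face minimising the sum over I
   contains the normals of all associated diagonals. *)

Arguments Rset : simpl never.

(** * Labels of the polygon and relations between the sets R_delta *)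

Section Labels.

Variables (n : nat) (D : {set 'I_n}).
Implicit Types (i j : 'I_n) (u v x y l r : 'I_n.+2) (A B I J : {set 'I_n}).

Lemma vtxE i : vtx i = i.+1 :> nat.
Proof. by []. Qed.

Lemma vtx_inj : injective (@vtx n).
Proof. by move=> i j /(congr1 val) [] /val_inj. Qed.

Lemma mem_vtx A i : (vtx i \in @vtx n @: A) = (i \in A).
Proof. exact: (mem_imset _ _ vtx_inj). Qed.

Lemma vtx_neq0 i : (vtx i == ord0) = false.
Proof. by []. Qed.

Lemma vtx_neq_max i : (vtx i == ord_max) = false.
Proof. by apply/eqP=> /(congr1 val) [] E; have := ltn_ord i; rewrite -{2}E ltnn. Qed.

Lemma ord0_vtx A : (ord0 \in @vtx n @: A) = false.
Proof. by apply/imsetP => -[i _ /eqP]; rewrite eq_sym vtx_neq0. Qed.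

Lemma ord_max_vtx A : (ord_max \in @vtx n @: A) = false.
Proof. by apply/imsetP => -[i _ /eqP]; rewrite eq_sym vtx_neq_max. Qed.

Lemma ord0_Dbar : ord0 \in Dbar D.
Proof. by rewrite !inE eqxx. Qed.

Lemma ord_max_Dbar : ord_max \in Dbar D.
Proof. by rewrite !inE eqxx orbT. Qed.

Lemma vtx_Dbar i : (vtx i \in Dbar D) = (i \in D).
Proof. by rewrite !inE vtx_neq0 vtx_neq_max mem_vtx. Qed.

Variant label_spec v : Prop :=
  | Label0 of v = ord0
  | LabelMax of v = ord_max
  | LabelVtx i of v = vtx i.

Lemma labelP v : label_spec v.
Proof.
have [->|v0] := eqVneq v ord0; first exact: Label0.
have [->|v1] := eqVneq v ord_max; first exact: LabelMax.
have lt_v : (v.-1 < n)%N.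
  have : (v : nat) != 0%N by [].
  have : (v : nat) != n.+1 by [].
  by have := ltn_ord v; lia.
apply: (LabelVtx (i := Ordinal lt_v)); apply: val_inj => /=.
have : (v : nat) != 0%N by [].
by rewrite /bump; lia.
Qed.

Lemma in_Rset x y i : (i \in Rset D (x, y)) =
  if x \in Dbar D then
    if y \in Dbar D then (i \in D) && (x < i.+1 < y)%N
    else if i \in D then (x < i.+1)%N else (y <= i.+1)%N
  else
    if y \in Dbar D then (if i \in D then (i.+1 < y)%N else (i.+1 <= x)%N)
    else [|| i \in D, (i.+1 <= x)%N | (y <= i.+1)%N].
Proof.
rewrite /Rset; case: (x \in Dbar D); case: (y \in Dbar D);
  rewrite !inE ?vtxE; case: (i \in D) => //=; rewrite ?orbF //.
Qed.

(* As indicators, R_{l,j} + R_{j,r} = R_{l,r} - j for j in D, and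
   R_{l,j} + R_{j,r} = R_{l,r} + j + [n] for j in U. *)
Lemma Rset_triangle l j r i : (l < vtx j)%N -> (vtx j < r)%N ->
  ((i \in Rset D (l, vtx j)) + (i \in Rset D (vtx j, r))
     + (j \in D) * (i == j) =
   (i \in Rset D (l, r)) + (j \notin D) * (i == j).+1)%N.
Proof.
move=> lj jr; rewrite !in_Rset vtx_Dbar; rewrite vtxE in lj jr *.
have [->|/eqP ij] := eqVneq i j.
  by case: (j \in D); case: (l \in Dbar D); case: (r \in Dbar D); lia.
have {}ij : (i : nat) <> j by move=> /val_inj.
by case: (i \in D); case: (j \in D); case: (l \in Dbar D); case: (r \in Dbar D); lia.
Qed.

(** The hypothesis is what an upward sweep produces: a lower end [r] is deleted in favour of one
    further out, or an upper end [r'] closer by is inserted. *)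
Lemma subset_Rset_r x r r' :
  (r \in Dbar D) && (r <= r')%N || (r' \notin Dbar D) && (r' <= r)%N ->
  Rset D (x, r) \subset Rset D (x, r').
Proof.
move=> H; apply/subsetP=> i; rewrite !in_Rset; move: H.
by case: (i \in D); case: (x \in Dbar D); case: (r \in Dbar D);
  case: (r' \in Dbar D); lia.
Qed.

Lemma subset_Rset_l l l' y :
  (l \in Dbar D) && (l' <= l)%N || (l' \notin Dbar D) && (l <= l')%N ->
  Rset D (l, y) \subset Rset D (l', y).
Proof.
move=> H; apply/subsetP=> i; rewrite !in_Rset; move: H.
by case: (i \in D); case: (y \in Dbar D); case: (l \in Dbar D);
  case: (l' \in Dbar D); lia.
Qed.

End Labels.

(** * Successors, predecessors and edge sums in a set of labels *)

Section Neighbours.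

Variable m : nat.
Implicit Types (S : {set 'I_m.+1}) (v w x : 'I_m.+1).

Definition nxt S v : 'I_m.+1 := [arg min_(y < ord_max | (y \in S) && (v < y)%N) y].

Definition prv S v : 'I_m.+1 := [arg max_(y > ord0 | (y \in S) && (y < v)%N) y].

Lemma nxtP S v : ord_max \in S -> v != ord_max ->
  [/\ nxt S v \in S, (v < nxt S v)%N
    & forall w, w \in S -> (v < w)%N -> (nxt S v <= w)%N].
Proof.
move=> maxS vmax; rewrite /nxt; case: arg_minnP => [|y /andP[yS vy] ymin].
  rewrite maxS /=; have : (v : nat) != m by [].
  by have := ltn_ord v; lia.
by split=> // w wS vw; apply: ymin; rewrite wS.
Qed.

Lemma prvP S v : ord0 \in S -> v != ord0 ->
  [/\ prv S v \in S, (prv S v < v)%N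
    & forall w, w \in S -> (w < v)%N -> (w <= prv S v)%N].
Proof.
move=> minS vmin; rewrite /prv; case: arg_maxnP => [|y /andP[yS vy] ymax].
  by rewrite minS /= lt0n.
by split=> // w wS vw; apply: ymax; rewrite wS.
Qed.

Lemma nxt_eq S v w : ord_max \in S -> v != ord_max -> w \in S -> (v < w)%N ->
  (forall x, x \in S -> (v < x)%N -> (w <= x)%N) -> nxt S v = w.
Proof.
move=> maxS vmax wS vw wmin; have [nS vn nmin] := nxtP maxS vmax.
by apply: val_inj; apply/eqP; rewrite eqn_leq nmin // wmin.
Qed.

Definition edge_sum (V : zmodType) (phi : 'I_m.+1 -> 'I_m.+1 -> V) S : V :=
  \sum_(v in S | v != ord_max) phi v (nxt S v).

(** Inserting [v] splits the edge from [prv S v] to [nxt S v] in two; every other vertex keeps its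
    successor. *)
Lemma edge_sumU1 (V : zmodType) (phi : 'I_m.+1 -> 'I_m.+1 -> V) S v :
  ord0 \in S -> ord_max \in S -> v \notin S ->
  edge_sum phi (v |: S) = edge_sum phi S
    + (phi (prv S v) v + phi v (nxt S v) - phi (prv S v) (nxt S v)).
Proof.
move=> S0 S1 vS.
have v0 : v != ord0 by apply: contraNneq vS => ->.
have v1 : v != ord_max by apply: contraNneq vS => ->.
have [rS vr rmin] := nxtP S1 v1; have [lS lv lmax] := prvP S0 v0.
set r := nxt S v in rS vr rmin *; set l := prv S v in lS lv lmax *.
have vS1 : ord_max \in v |: S by rewrite inE S1 orbT.
have l1 : l != ord_max.
  by apply: contraTneq lv => ->; rewrite -leqNgt -ltnS ltn_ord.
have nxtv : nxt (v |: S) v = r.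
  apply: nxt_eq => //; first by rewrite inE rS orbT.
  by move=> x; rewrite !inE => /orP[/eqP->|xS vx]; rewrite ?ltnn //; apply: rmin.
have nxtl : nxt (v |: S) l = v.
  apply: nxt_eq => //; first by rewrite !inE eqxx.
  move=> x; rewrite !inE => /orP[/eqP->//|xS lx].
  by rewrite leqNgt; apply/negP => /(lmax _ xS); rewrite leqNgt lx.
have nxtlS : nxt S l = r.
  apply: nxt_eq => //; first exact: ltn_trans vr.
  move=> x xS lx; apply: rmin => //; rewrite ltn_neqAle; apply/andP; split.
    by apply: contraNneq vS => /val_inj ->.
  by rewrite leqNgt; apply/negP => /(lmax _ xS); rewrite leqNgt lx.
rewrite /edge_sum (bigD1 v) /=; last by rewrite !inE eqxx v1.
rewrite (bigD1 l) /=; last first.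
  by rewrite !inE lS l1 orbT /=; apply: contraTneq lv => ->; rewrite ltnn.
rewrite [in RHS](bigD1 l) /=; last by rewrite lS.
rewrite nxtv nxtl nxtlS.
rewrite [X in _ + (_ + X)](_ : _ =
  \sum_(i in S | (i != ord_max) && (i != l)) phi i (nxt S i)); last first.
  apply: eq_big => [x|x].
    rewrite !inE; case: (eqVneq x v) => [->|_]; rewrite ?(negPf vS) //=.
      by rewrite andbF.
    by rewrite andbT andbA.
  rewrite !inE => /andP[/andP[/andP[+ x1] xv] xl].
  rewrite (negPf xv) /= => xS; congr (phi _ _).
  have [nS xn nmin] := nxtP S1 x1.
  apply: nxt_eq => //; first by rewrite inE nS orbT.
  move=> y; rewrite !inE => /orP[/eqP-> xv'|]; last exact: nmin.
  have xl' : (x < l)%N.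
    rewrite ltn_neqAle lmax // andbT; apply: contraNneq xl => /val_inj ->.
    exact: eqxx.
  by apply: leq_trans (ltnW lv); apply: nmin.
rewrite [X in _ = _ + X + _](_ : _ =
  \sum_(i in S | (i != ord_max) && (i != l)) phi i (nxt S i)); last first.
  by apply: eq_bigl => x; rewrite andbA.
rewrite addrA [LHS]addrC [X in _ = X + _]addrC addrACA subrr addr0.
by congr (_ + _); exact: addrC.
Qed.

End Neighbours.

(** * Sweep paths and their supermodular bound *)

Section SweepPath.

Variables (R : realFieldType) (n : nat) (D : {set 'I_n}).
Implicit Types (i j : 'I_n) (u v w x y l r : 'I_n.+2) (A B I J : {set 'I_n}).

(* The x-monotone path from 0 to n+1 obtained from the lower boundary of the
   polygon by deleting the vertices of A in D and inserting those in U. *)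
Definition sweep_path A : {set 'I_n.+2} :=
  [set v | (v \in Dbar D) != (v \in @vtx n @: A)].

Lemma in_sweep A v :
  (v \in sweep_path A) = ((v \in Dbar D) != (v \in @vtx n @: A)).
Proof. by rewrite inE. Qed.

Lemma ord0_sweep A : ord0 \in sweep_path A.
Proof. by rewrite inE ord0_Dbar ord0_vtx. Qed.

Lemma ord_max_sweep A : ord_max \in sweep_path A.
Proof. by rewrite inE ord_max_Dbar ord_max_vtx. Qed.

Lemma vtx_sweep A i : (vtx i \in sweep_path A) = ((i \in D) != (i \in A)).
Proof. by rewrite inE vtx_Dbar mem_vtx. Qed.

(** For [j] outside [A], adding [j] toggles its vertex: it leaves the path if [j] is in D and enters
    it otherwise. The core lacks it in both cases, so the neighbours of [j] are defined
    uniformly. *)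
Definition sweep_core A j := sweep_path A :\ vtx j.

Lemma ord0_core A j : ord0 \in sweep_core A j.
Proof. by rewrite !in_setD1 eq_sym vtx_neq0 ord0_sweep. Qed.

Lemma ord_max_core A j : ord_max \in sweep_core A j.
Proof. by rewrite !in_setD1 eq_sym vtx_neq_max ord_max_sweep. Qed.

(** The core together with [j] is the path before the step if [j] is in D, and the path after it
    otherwise; hence the sign. *)
Lemma edge_sum_sweepU1 (phi : 'I_n.+2 -> 'I_n.+2 -> R) A j : j \notin A ->
  let l := prv (sweep_core A j) (vtx j) in
  let r := nxt (sweep_core A j) (vtx j) in
  edge_sum phi (sweep_path (j |: A)) = edge_sum phi (sweep_path A)
    + (-1) ^+ (j \in D) * (phi l (vtx j) + phi (vtx j) r - phi l r).
Proof.
move=> jA l r; have jS : vtx j \notin sweep_core A j by rewrite !inE eqxx.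
have := edge_sumU1 phi (ord0_core A j) (ord_max_core A j) jS.
rewrite -/l -/r; have [jD|jD] := boolP (j \in D).
  have -> : vtx j |: sweep_core A j = sweep_path A.
    by rewrite setD1K // vtx_sweep jD (negPf jA).
  have -> : sweep_path (j |: A) = sweep_core A j.
    apply/setP=> v; rewrite in_setD1 !in_sweep imsetU1 [v \in vtx j |: _]in_setU1.
    by case: (eqVneq v (vtx j)) => [->|_]; rewrite ?vtx_Dbar ?jD ?eqxx.
  by move=> ->; rewrite expr1 mulN1r addrK.
have -> : vtx j |: sweep_core A j = sweep_path (j |: A).
  apply/setP=> v; rewrite in_setU1 in_setD1 !in_sweep imsetU1 [v \in vtx j |: _ @:
    _]in_setU1.
  by case: (eqVneq v (vtx j)) => [->|_]; rewrite ?vtx_Dbar ?(negPf jD) ?eqxx.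
have -> : sweep_core A j = sweep_path A.
  apply/setP=> v; rewrite in_setD1; case: (eqVneq v (vtx j)) => [->|//].
  by rewrite vtx_sweep (negPf jD) (negPf jA).
by move=> ->; rewrite expr0 mul1r.
Qed.

Lemma prv_core A j (l := prv (sweep_core A j) (vtx j)) :
  [/\ l \in sweep_path A, (l < vtx j)%N
    & forall w, w \in sweep_path A -> (w < vtx j)%N -> (w <= l)%N].
Proof.
have v0 : vtx j != ord0 by rewrite vtx_neq0.
have [] := prvP (ord0_core A j) v0; rewrite -/l in_setD1 => /andP[_ lS] lj lmax.
split=> // w wS wj; apply: lmax => //; rewrite in_setD1 wS andbT.
by apply: contraTneq wj => ->; rewrite ltnn.
Qed.

Lemma nxt_core A j (r := nxt (sweep_core A j) (vtx j)) :
  [/\ r \in sweep_path A, (vtx j < r)%N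
    & forall w, w \in sweep_path A -> (vtx j < w)%N -> (r <= w)%N].
Proof.
have v1 : vtx j != ord_max by rewrite vtx_neq_max.
have [] := nxtP (ord_max_core A j) v1; rewrite -/r in_setD1 => /andP[_ rS] jr rmin.
split=> // w wS jw; apply: rmin => //; rewrite in_setD1 wS andbT.
by apply: contraTneq jw => ->; rewrite ltnn.
Qed.

Lemma sum_mem A (y : 'I_n -> R) : \sum_(i in A) y i = \sum_i y i * (i \in A)%:R.
Proof.
rewrite big_mkcond; apply: eq_bigr => i _.
by case: (i \in A); rewrite ?mulr1 ?mulr0.
Qed.

Lemma sum_Rset_triangle (y : 'I_n -> R) l j r : (l < vtx j)%N -> (vtx j < r)%N ->
  \sum_(i in Rset D (l, vtx j)) y i + \sum_(i in Rset D (vtx j, r)) y i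
    - \sum_(i in Rset D (l, r)) y i =
  (-1) ^+ (j \in D) * y j + (j \notin D)%:R * \sum_i y i.
Proof.
move=> lj jr.
have -> : y j = \sum_i y i * (i == j)%:R.
  rewrite (bigD1 j) //= eqxx mulr1 big1 ?addr0 // => i /negPf ->.
  by rewrite mulr0.
rewrite !sum_mem -big_split /= -sumrB !mulr_sumr -big_split /=.
apply: eq_bigr => i _.
have /(congr1 (fun k : nat => k%:R : R)) := Rset_triangle D i lj jr.
rewrite !natrD !natrM -[_.+1%:R]natr1.
case: (j \in D) => /=; rewrite ?mul1r ?mul0r ?expr1 ?expr0 ?addr0 ?add0r => E.
  have -> : (i == j)%:R = (i \in Rset D (l, r))%:R
     - ((i \in Rset D (l, vtx j))%:R + (i \in Rset D (vtx j, r))%:R) :> R.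
    by rewrite -E addrC addKr.
  by ring.
have -> : (i == j)%:R = (i \in Rset D (l, vtx j))%:R
   + (i \in Rset D (vtx j, r))%:R - (i \in Rset D (l, r))%:R - 1 :> R.
  by rewrite E; ring.
by ring.
Qed.

Definition crd u v : R := #|Rset D (u, v)|%:R.

Lemma crd_ge0 u v : 0 <= crd u v. Proof. exact: ler0n. Qed.

Lemma crd_le u v : crd u v <= n%:R.
Proof. by rewrite ler_nat -[leqRHS]card_ord max_card. Qed.

Lemma crd_subset u v x y : Rset D (u, v) \subset Rset D (x, y) -> crd u v <= crd x y.
Proof. by move=> sub; rewrite ler_nat subset_leq_card. Qed.

Lemma crd_triangle l j r : (l < vtx j)%N -> (vtx j < r)%N ->
  crd l r = crd l (vtx j) + crd (vtx j) r
              - (if j \in D then -1 else n.+1%:R).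
Proof.
move=> lj jr; have := sum_Rset_triangle (fun=> 1) lj jr.
rewrite !sumr_const card_ord -/(crd _ _) -/(crd _ _) -/(crd _ _).
by case: (j \in D) => /=; rewrite ?expr1 ?expr0 ?mulr1 ?mul0r ?mul1r -?natr1; lra.
Qed.

(** With c = |R_delta|, half of this is (n+1) c / 2 - c (c+1) / 2: the negated facet bound of the
    associahedron once each coordinate is centred at (n+1)/2. *)
Definition bump_weight u v : R := crd u v * (n%:R - crd u v).

(* For the associahedron translated by (n+1)/2 in each coordinate, this is the
   minimum of the coordinate sum over A. *)
Definition sweep_bound A : R := - edge_sum bump_weight (sweep_path A) / 2.

(** [crd_triangle] eliminates the third cardinality. In product form both increments are visibly
    nondecreasing in [p] and [q] on [0, n]. *)
Lemma sweep_boundU1 A j : j \notin A ->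
  let p := crd (prv (sweep_core A j) (vtx j)) (vtx j) in
  let q := crd (vtx j) (nxt (sweep_core A j) (vtx j)) in
  sweep_bound (j |: A) - sweep_bound A =
    if j \in D then (p + 1) * (q + 1) - n.+1%:R / 2
    else n.+1%:R / 2 - (n%:R - p + 1) * (n%:R - q + 1).
Proof.
move=> jA p q; have [_ lj _] := prv_core A j; have [_ jr _] := nxt_core A j.
rewrite /sweep_bound edge_sum_sweepU1 // /bump_weight (crd_triangle lj jr).
rewrite -/p -/q -natr1.
by case: (j \in D); rewrite ?expr1 ?expr0; field.
Qed.

(** Growing the set only deletes vertices of D from the path and inserts vertices of U. *)
Lemma sweep_path_subset A B v : A \subset B ->
  (v \in sweep_path A) != (v \in sweep_path B) ->
    (v \in Dbar D) = (v \in sweep_path A).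
Proof.
move=> AB; rewrite !in_sweep.
have : v \in @vtx n @: A -> v \in @vtx n @: B by apply/subsetP: v; exact: imsetS.
by case: (v \in Dbar D); case: (v \in _ @: A) => [/(_ isT)->|_]; case: (v \in _ @: B).
Qed.

(** If the two predecessors differ, the one closer to [j] lies on one path only: it is an inserted
    vertex of U or a deleted vertex of D. Either change enlarges the set. *)
Lemma subset_Rset_prv A B j : A \subset B -> j \notin B ->
  Rset D (prv (sweep_core A j) (vtx j), vtx j)
    \subset Rset D (prv (sweep_core B j) (vtx j), vtx j).
Proof.
move=> AB jB; have [lA ljA maxA] := prv_core A j.
have [lB ljB maxB] := prv_core B j.
set a := prv _ _ in lA ljA maxA *; set b := prv _ _ in lB ljB maxB *.
apply: subset_Rset_l.
have [ab|ba|/val_inj ->] := ltngtP a b; last by rewrite !andbT orbN.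
  have bA : b \notin sweep_path A.
    by apply/negP => /maxA /(_ ljB); rewrite leqNgt ab.
  by rewrite andbT andbF /= (sweep_path_subset AB) ?lB // (negPf bA).
have aB : a \notin sweep_path B.
  by apply/negP => /maxB /(_ ljA); rewrite leqNgt ba.
by rewrite andbT andbF orbF (sweep_path_subset AB) ?lA // (negPf aB).
Qed.

Lemma subset_Rset_nxt A B j : A \subset B -> j \notin B ->
  Rset D (vtx j, nxt (sweep_core A j) (vtx j))
    \subset Rset D (vtx j, nxt (sweep_core B j) (vtx j)).
Proof.
move=> AB jB; have [rA jrA minA] := nxt_core A j.
have [rB jrB minB] := nxt_core B j.
set a := nxt _ _ in rA jrA minA *; set b := nxt _ _ in rB jrB minB *.
apply: subset_Rset_r.
have [ab|ba|/val_inj ->] := ltngtP a b; last by rewrite !andbT orbN.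
  have aB : a \notin sweep_path B.
    by apply/negP => /minB /(_ jrA); rewrite leqNgt ab.
  by rewrite andbT andbF orbF (sweep_path_subset AB) ?rA // (negPf aB).
have bA : b \notin sweep_path A.
  by apply/negP => /minA /(_ jrB); rewrite leqNgt ba.
by rewrite andbT andbF /= (sweep_path_subset AB) ?rB // (negPf bA).
Qed.

Lemma sweep_bound_supermodular A B j : A \subset B -> j \notin B ->
  sweep_bound (j |: A) - sweep_bound A <= sweep_bound (j |: B) - sweep_bound B.
Proof.
move=> AB jB; have jA : j \notin A by apply: contra jB; apply: (subsetP AB).
have /= -> := sweep_boundU1 jA; have /= -> := sweep_boundU1 jB.
have : crd (prv (sweep_core A j) (vtx j)) (vtx j)
         <= crd (prv (sweep_core B j) (vtx j)) (vtx j).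
  exact/crd_subset/subset_Rset_prv.
have : crd (vtx j) (nxt (sweep_core A j) (vtx j))
         <= crd (vtx j) (nxt (sweep_core B j) (vtx j)).
  exact/crd_subset/subset_Rset_nxt.
move: (crd_ge0 (prv (sweep_core A j) (vtx j)) (vtx j))
  (crd_ge0 (vtx j) (nxt (sweep_core A j) (vtx j)))
  (crd_le (prv (sweep_core B j) (vtx j)) (vtx j))
  (crd_le (vtx j) (nxt (sweep_core B j) (vtx j))).
move: (crd _ _) (crd _ _) (crd _ _) (crd _ _) (n%:R) (n.+1%:R / 2).
by move=> p q p' q' N h p0 q0 p1 q1 qq pp; case: (j \in D); nra.
Qed.

Lemma set_induct (P : {set 'I_n} -> Prop) : P set0 ->
  (forall A j, j \notin A -> P A -> P (j |: A)) -> forall A, P A.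
Proof.
move=> P0 PU A; have [k] := ubnP #|A|; elim: k A => // k IHk A.
have [->//|/set0Pn[j jA]] := eqVneq A set0.
by rewrite -{2}(setD1K jA) (cardsD1 j) jA => lt_Ak; apply: PU;
  [rewrite !inE eqxx | exact: IHk].
Qed.

Lemma Rset_sweep0 v : v \in sweep_path set0 -> v != ord_max ->
  Rset D (v, nxt (sweep_path set0) v) = set0.
Proof.
move=> vS v1; have [wS vw wmin] := nxtP (ord_max_sweep set0) v1.
set w := nxt _ _ in wS vw wmin *; apply/setP=> i; rewrite in_Rset [RHS]inE.
have -> : v \in Dbar D by move: vS; rewrite in_sweep imset0 [v \in set0]inE;
  case: (_ \in _).
have -> : w \in Dbar D by move: wS; rewrite in_sweep imset0 [w \in set0]inE;
  case: (_ \in _).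
apply/negP => /and3P[iD vi iw].
have /wmin /(_ vi) : vtx i \in sweep_path set0 by rewrite vtx_sweep iD inE.
by rewrite vtxE leqNgt iw.
Qed.

(** The path of [n] is the upper boundary: its only vertices in [Dbar D] are 0 and n+1, and it skips
    no element of U. *)
Lemma Rset_sweepT v : v \in sweep_path setT -> v != ord_max ->
  Rset D (v, nxt (sweep_path setT) v) = setT.
Proof.
move=> vS v1; have [wS vw wmin] := nxtP (ord_max_sweep setT) v1.
set w := nxt _ _ in wS vw wmin *; apply/setP=> i; rewrite in_Rset [RHS]inE.
have H : i \notin D -> (v < i.+1)%N -> (w <= i.+1)%N.
  by move=> /negPf iD vi; apply: (wmin (vtx i)) => //; rewrite vtx_sweep iD inE.
have v0 : v \in Dbar D -> (v : nat) = 0%N.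
  case: (labelP v) vS v1 => [->|->|k ->]; rewrite ?eqxx // vtx_sweep inE vtx_Dbar.
  by case: (k \in D).
have w1 : w \in Dbar D -> (w : nat) = n.+1.
  case: (labelP w) wS vw => [->|->|k ->]; rewrite ?ltn0 // vtx_sweep inE vtx_Dbar.
  by case: (k \in D).
have := ltn_ord i; move: H v0 w1.
by case: (v \in Dbar D); case: (w \in Dbar D); case: (i \in D); lia.
Qed.

(** By the triangle relation each element [j] added to the set contributes [y j]: the two signs
    cancel, and the multiple of the total sum vanishes. *)
Lemma edge_sum_sweep (y : 'I_n -> R) A : \sum_i y i = 0 ->
  edge_sum (fun u v => \sum_(i in Rset D (u, v)) y i) (sweep_path A) =
  \sum_(i in A) y i.
Proof.
move=> y0; elim/set_induct: A => [|A j jA IH].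
  rewrite big_set0 /edge_sum big1 // => v /andP[vS v1].
  by rewrite Rset_sweep0 // big_set0.
rewrite edge_sum_sweepU1 // IH big_setU1 //= addrC; congr (_ + _).
have [_ lj _] := prv_core A j; have [_ jr _] := nxt_core A j.
by rewrite sum_Rset_triangle // y0 mulr0 addr0 mulrA -expr2 sqrr_sign mul1r.
Qed.

Lemma bump_weight0 u v : Rset D (u, v) = set0 \/ Rset D (u, v) = setT ->
  bump_weight u v = 0.
Proof.
by rewrite /bump_weight /crd => -[]->;
  rewrite ?cards0 ?cardsT ?card_ord ?mul0r ?subrr ?mulr0.
Qed.

Lemma sweep_bound0 : sweep_bound set0 = 0.
Proof.
rewrite /sweep_bound /edge_sum big1 ?oppr0 ?mul0r // => v /andP[vS v1].
by apply: bump_weight0; left; exact: Rset_sweep0.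
Qed.

Lemma sweep_boundT : sweep_bound setT = 0.
Proof.
rewrite /sweep_bound /edge_sum big1 ?oppr0 ?mul0r // => v /andP[vS v1].
by apply: bump_weight0; right; exact: Rset_sweepT.
Qed.

(** Geometrically, the path of R_delta follows the boundary on the side of [x], crosses by delta,
    and continues along the boundary on the side of [y]; 0 and n+1 count for both sides. *)
Lemma sweep_path_Rset x y z : (x < y)%N -> z \in sweep_path (Rset D (x, y)) ->
  if (z <= x)%N then ((x \in Dbar D) == (z \in Dbar D)) || (z == ord0)
  else (y <= z)%N && (((y \in Dbar D) == (z \in Dbar D)) || (z == ord_max)).
Proof.
move=> xy; case: (labelP z) => [->|->|k ->]; first by rewrite leq0n eqxx orbT.
  move=> _; case: ifP => [/= xn|_]; first by have := ltn_ord y; lia.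
  by rewrite -ltnS ltn_ord; apply/orP; right.
rewrite vtx_sweep in_Rset vtx_Dbar vtx_neq0 vtx_neq_max vtxE.
case: (leqP k.+1 x) => kx; case: (k \in D); case: (x \in Dbar D);
  case: (y \in Dbar D) => //=; lia.
Qed.

Lemma Rset_ends_sweep x y : (x < y)%N ->
  x \in sweep_path (Rset D (x, y)) /\ y \in sweep_path (Rset D (x, y)).
Proof.
move=> xy; split.
  case: (labelP x) => [->|->|k ->]; rewrite ?ord0_sweep ?ord_max_sweep //.
  by rewrite vtx_sweep in_Rset vtx_Dbar vtxE leqnn ltnn; case: (k \in D);
    case: (_ \in _).
move: xy; case: (labelP y) => [->|->|k ->]; rewrite ?ord0_sweep ?ord_max_sweep //.
rewrite vtx_sweep in_Rset vtx_Dbar vtxE leqnn ltnn andbF => xk.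
by case: (k \in D); case: (_ \in _); rewrite ?orbT.
Qed.

(** Every edge of this path except delta is a boundary edge: lower ones give the empty set, upper
    ones [n]. *)
Lemma Rset_sweep_Rset x y v : (x < y)%N ->
    v \in sweep_path (Rset D (x, y)) -> v != ord_max -> v != x ->
  let w := nxt (sweep_path (Rset D (x, y))) v in
  Rset D (v, w) = set0 \/ Rset D (v, w) = setT.
Proof.
move=> xy vS v1 vx w; have [wS vw wmin] := nxtP (ord_max_sweep (Rset D (x, y))) v1.
rewrite -/w in wS vw wmin *.
have [xS _] := Rset_ends_sweep xy.
have wx : (v < x)%N -> (w <= x)%N by exact: wmin.
have {}vx : (v : nat) <> x by move=> /val_inj /eqP; rewrite (negPf vx).
have vE := sweep_path_Rset xy vS; have wE := sweep_path_Rset xy wS.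
have H i : (i \in D) != (i \in Rset D (x, y)) -> (v < i.+1)%N -> (w <= i.+1)%N.
  by move=> iD vi; apply: (wmin (vtx i)) => //; rewrite vtx_sweep.
have i1 (i : 'I_n) : (0 < i.+1 < n.+1)%N by rewrite /= ltnS ltn_ord.
have [vlx|xlv] := leqP v x.
  have {}vlx : (v < x)%N by rewrite ltn_neqAle vlx andbT; apply/eqP.
  have wlx := wx vlx; rewrite wlx in wE.
  have {}wE : (x \in Dbar D) = (w \in Dbar D).
    case/orP: wE => /eqP // w0; by rewrite w0 ltn0 in vw.
  rewrite (ltnW vlx) in vE; have [xD|xD] := boolP (x \in Dbar D); [left|right].
    have vD : v \in Dbar D.
      by case/orP: vE => /eqP E; [rewrite -E | rewrite E ord0_Dbar].
    apply/setP=> i; rewrite in_Rset vD -wE xD [RHS]inE.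
    apply/negP => /and3P[iD vi iw]; have := H i; rewrite iD in_Rset xD iD.
    by clear -vi iw wlx; case: (y \in Dbar D) => /=; lia.
  apply/setP=> i; have := H i; rewrite !in_Rset -wE (negPf xD) [RHS]inE.
  have v0 : v \in Dbar D -> (v : nat) = 0%N.
    by case/orP: vE => /eqP E; [rewrite -E (negPf xD) | rewrite E].
  move: v0 (i1 i).
  clear -xy vlx wlx vw.
  by case: (i \in D); case: (v \in Dbar D); case: (y \in Dbar D) => //=; lia.
rewrite leqNgt xlv /= in vE; case/andP: vE => yv vE.
rewrite leqNgt (ltn_trans xlv vw) /= in wE; case/andP: wE => yw wE.
have {}vE : (y \in Dbar D) = (v \in Dbar D).
  by case/orP: vE => /eqP // v1'; rewrite v1' eqxx in v1.
have [yD|yD] := boolP (y \in Dbar D); [left|right].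
  have wD : w \in Dbar D.
    by case/orP: wE => /eqP E; [rewrite -E | rewrite E ord_max_Dbar].
  apply/setP=> i; rewrite in_Rset wD -vE yD [RHS]inE.
  apply/negP => /and3P[iD vi iw]; have := H i; rewrite iD in_Rset yD iD.
  by clear -vi iw yv; case: (x \in Dbar D) => /=; lia.
apply/setP=> i; have := H i; rewrite !in_Rset -vE (negPf yD) [RHS]inE.
have w1 : w \in Dbar D -> (w : nat) = n.+1.
  by case/orP: wE => /eqP E; [rewrite -E (negPf yD) | rewrite E].
move: w1 (i1 i).
clear -xy xlv yv yw vw.
by case: (i \in D); case: (w \in Dbar D); case: (x \in Dbar D) => //=; lia.
Qed.

(** Only the edge delta has a contribution, the others having weight zero; the two sides in fact
    agree. *)
Lemma sweep_bound_Rset x y : (x < y)%N ->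
  - bump_weight x y / 2 <= sweep_bound (Rset D (x, y)).
Proof.
move=> xy; have [xS yS] := Rset_ends_sweep xy.
have x1 : x != ord_max by apply: contraTneq xy => ->; rewrite -leqNgt -ltnS ltn_ord.
have nxtx : nxt (sweep_path (Rset D (x, y))) x = y.
  apply: nxt_eq => //; first exact: ord_max_sweep.
  by move=> z zS xz; have := sweep_path_Rset xy zS; rewrite leqNgt xz => /andP[].
rewrite /sweep_bound /edge_sum (bigD1 x) /= ?xS // nxtx big1 ?addr0 //.
move=> v /andP[/andP[vS v1] vx]; apply: bump_weight0.
exact: Rset_sweep_Rset.
Qed.

End SweepPath.

(** * The greedy algorithm for supermodular functions *)

Section Greedy.

Variables (R : realFieldType) (n : nat) (z : {set 'I_n} -> R).
Implicit Types (A B I J : {set 'I_n}) (y : 'I_n -> R).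

Hypothesis z_supermodular : forall A B j, A \subset B -> j \notin B ->
  z (j |: A) - z A <= z (j |: B) - z B.

(** Elements of [B] outside [A] are added one at a time, the new coordinate being the increment of
    [z]. For a set [J] containing the new [j], supermodularity compares the increments at [J :\ j]
    and at [A]. *)
Lemma greedy_extend A B y : A \subset B ->
    (forall J, J \subset A -> z J <= \sum_(i in J) y i) ->
    \sum_(i in A) y i = z A ->
  exists y', [/\ forall i, i \in A -> y' i = y i,
    forall J, J \subset B -> z J <= \sum_(i in J) y' i
    & \sum_(i in B) y' i = z B].
Proof.
have [k] := ubnP #|B :\: A|; elim: k A y => // k IHk A y lt_k AB yA yAe.
have [BA|/set0Pn[j]] := eqVneq (B :\: A) set0.
  have -> : B = A by apply/eqP; rewrite eqEsubset AB -setD_eq0 BA eqxx.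
  by exists y.
rewrite inE => /andP[jA jB].
pose y1 i := if i == j then z (j |: A) - z A else y i.
have y1y J : j \notin J -> \sum_(i in J) y1 i = \sum_(i in J) y i.
  move=> jJ; apply: eq_bigr => i iJ; rewrite /y1.
  by case: eqP => // ij; rewrite -ij iJ in jJ.
have [||||y' [y'1 y'B y'Be]] := IHk (j |: A) y1.
- rewrite -ltnS (leq_trans _ lt_k) // ltnS.
  apply: (@leq_ltn_trans #|(B :\: A) :\ j|).
    by apply/subset_leq_card/subsetP => i; rewrite !inE negb_or andbA.
  by rewrite [X in (_ < X)%N](cardsD1 j) inE jA jB.
- by rewrite subUset sub1set jB.
- move=> J JA; have [jJ|jJ] := boolP (j \in J); last first.
    rewrite y1y //; apply: yA; apply/subsetP=> i iJ.
    have := subsetP JA i iJ; rewrite !inE => /orP[/eqP ij|//].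
    by rewrite -ij iJ in jJ.
  have sub : J :\ j \subset A.
    apply/subsetP=> i; rewrite !inE => /andP[ij iJ].
    by have := subsetP JA i iJ; rewrite !inE (negPf ij).
  rewrite (big_setD1 j) //= y1y ?inE ?eqxx // /y1 eqxx.
  have := yA _ sub; have := z_supermodular sub jA; rewrite setD1K //; lra.
- by rewrite big_setU1 //= y1y // yAe /y1 eqxx subrK.
exists y'; split=> // i iA; rewrite y'1 ?inE ?iA ?orbT // /y1.
by case: eqP => // ij; rewrite -ij iA in jA.
Qed.

(** The chain runs from the empty set through [I] to [n]; the second extension keeps the coordinates
    in [I]. *)
Lemma greedy I : z set0 = 0 -> exists y, [/\ forall J, z J <= \sum_(i in J) y i,
  \sum_(i in I) y i = z I & \sum_i y i = z setT].
Proof.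
move=> z0; have [|||y [_ yI yIe]] := @greedy_extend set0 I (fun=> 0).
- exact: sub0set.
- by move=> J; rewrite subset0 => /eqP->; rewrite z0 big_set0.
- by rewrite z0 big_set0.
have [y' [y'y y'T y'Te]] := greedy_extend (subsetT I) yI yIe.
exists y'; split; first by move=> J; apply: y'T; exact: subsetT.
  by rewrite -yIe; apply: eq_bigr => i /y'y.
by rewrite -y'Te; apply: eq_bigl => i; rewrite inE.
Qed.

End Greedy.

(** * Sweep points and facet centres of the associahedron *)

Section AssociahedronPoints.

Variables (R : realType) (n : nat) (D : {set 'I_n}).
Implicit Types (I S : {set 'I_n}) (x y : 'rV[R]_n).

Definition simplex_bound S : R := (#|S| * #|S|.+1)%N%:R / 2.

Lemma coord_sum_shift (y : 'I_n -> R) (c : R) S :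
  coord_sum S (\row_i (y i + c)) = \sum_(i in S) y i + c * #|S|%:R.
Proof.
rewrite /coord_sum (eq_bigr (fun i => y i + c)) => [|i _]; last by rewrite mxE.
by rewrite big_split /= sumr_const mulr_natr.
Qed.

Lemma simplex_boundE u v : simplex_bound (Rset D (u, v)) =
  - bump_weight R D u v / 2 + n.+1%:R / 2 * #|Rset D (u, v)|%:R.
Proof. by rewrite /simplex_bound /bump_weight /crd natrM -!natr1; field. Qed.

Lemma associahedron_sweep_point I : exists2 x, associahedron D x &
  forall u, u \in sweep_path D I -> u != ord_max ->
    let S := Rset D (u, nxt (sweep_path D I) u) in coord_sum S x = simplex_bound S.
Proof.
have [y [yge yI yT]] :=
  greedy (@sweep_bound_supermodular R n D) I (sweep_bound0 R D).
have ge (u v : 'I_n.+2) : (u < v)%N ->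
    - bump_weight R D u v / 2 <= \sum_(i in Rset D (u, v)) y i.
  by move=> uv; apply: le_trans (yge _); exact: sweep_bound_Rset.
exists (\row_i (y i + n.+1%:R / 2)).
  split; rewrite ?coord_sum_shift.
    rewrite (eq_bigl xpredT) => [|i]; last by rewrite inE.
    by rewrite yT sweep_boundT add0r cardsT card_ord natrM; field.
  case=> u v /andP[/= uv _]; rewrite -/(simplex_bound _) simplex_boundE.
  by rewrite coord_sum_shift lerD2r ge.
have yT0 : \sum_i y i = 0 by rewrite yT sweep_boundT.
(* The slacks along the path are nonnegative, and their total is the sum of [y] over [I] minus
   [sweep_bound] of [I], which is zero; so each slack vanishes. *)
have := edge_sum_sweep D I yT0; rewrite yI /sweep_bound mulNr => /eqP.
rewrite -subr_eq0 opprK /edge_sum mulr_suml -big_split /= => /eqP sum0.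
move=> u uI u1; rewrite coord_sum_shift simplex_boundE; congr (_ + _).
have := psumr_eq0P _ sum0 (i := u); rewrite uI u1 => /(_ _ isT) E.
apply/eqP; rewrite mulNr -addr_eq0 E // => v /andP[vI v1].
have [_ vw _] := nxtP (ord_max_sweep D I) v1.
by have := ge _ _ vw; rewrite mulNr; lra.
Qed.

(** The two constants are the averages of 1, ..., |S| and of |S|+1, ..., n. *)
Definition facet_point S : 'rV[R]_n :=
  \row_i (if i \in S then #|S|.+1%:R / 2 else (n + #|S|).+1%:R / 2).

(** As a sum of products of natural numbers, the excess is clearly nonnegative and vanishes only
    termwise. The subtractions do not truncate, by [le1] and [le2]. *)
Lemma facet_point_excess S T : coord_sum T (facet_point S) - simplex_bound T =
  (#|T :&: S| * (#|S| - #|T :&: S|)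
   + #|T :\: S| * (#|~: S| - #|T :\: S|)
   + 2 * #|T :\: S| * (#|S| - #|T :&: S|))%N%:R / 2.
Proof.
have le1 : (#|T :&: S| <= #|S|)%N by rewrite subset_leq_card // subsetIr.
have le2 : (#|T :\: S| <= #|~: S|)%N by rewrite subset_leq_card // setDE subsetIr.
have nE : n = (#|S| + #|~: S|)%N by rewrite cardsC card_ord.
rewrite /coord_sum (big_setID S) /=.
rewrite (eq_bigr (fun=> #|S|.+1%:R / 2)); last first.
  by move=> i; rewrite inE mxE => /andP[_ ->].
rewrite [X in _ + X - _](eq_bigr (fun=> (n + #|S|).+1%:R / 2)); last first.
  by move=> i; rewrite inE mxE => /andP[/negPf-> _].
rewrite !sumr_const /simplex_bound -[#|T|](cardsID S).
have := subnKC le2; have := subnKC le1; rewrite [X in (X + #|S|)%N]nE.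
set a := #|T :&: S|; set b := #|T :\: S|.
move: (#|S| - a)%N (#|~: S| - b)%N => p q <- <-.
by move: a b => {le1 le2} a b; field.
Qed.

Lemma facet_point_ge S T : simplex_bound T <= coord_sum T (facet_point S).
Proof. by rewrite -subr_ge0 facet_point_excess divr_ge0 ?ler0n. Qed.

Lemma facet_point_tight S : coord_sum S (facet_point S) = simplex_bound S.
Proof.
apply/eqP; rewrite -subr_eq0 facet_point_excess setIid setDv cards0 subnn.
by rewrite muln0 mul0n muln0 mul0r.
Qed.

(** All three products vanish. If [T] is contained in [S], the first one leaves the empty set or
    [S]; otherwise the third puts [S] inside [T] and the second the complement of [S]. *)
Lemma facet_point_tightP S T : coord_sum T (facet_point S) = simplex_bound T ->
  [\/ T = set0, T = S | T = setT].
Proof.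
move=> /eqP; rewrite -subr_eq0 facet_point_excess mulf_eq0 invr_eq0 !pnatr_eq0 orbF.
rewrite !addn_eq0 !muln_eq0 !subn_eq0 !cards_eq0 /= => /andP[/andP[T1 T2] T3].
have TS : (#|S| <= #|T :&: S|)%N -> S \subset T.
  move=> le; have /eqP <- : T :&: S == S by rewrite eqEcard subsetIr.
  exact: subsetIl.
have [TS0|TS0] := eqVneq (T :\: S) set0.
  case/orP: T1 => [/eqP TI|/TS ST].
    by apply: Or31; rewrite -(setID T S) TI TS0 setU0.
  apply: Or32; apply/eqP; rewrite eqEsubset ST andbT -setD_eq0.
  exact/eqP.
rewrite (negPf TS0) /= in T2 T3; apply: Or33; apply/eqP.
rewrite eqEsubset subsetT -(setUCr S) subUset TS //=.
have /eqP <- : T :\: S == ~: S by rewrite eqEcard T2 setDE subsetIr.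
exact: subsetDl.
Qed.

Lemma facet_point_associahedron S : associahedron D (facet_point S).
Proof.
split=> [|delta _]; last exact: facet_point_ge.
apply/eqP; rewrite -subr_eq0 -/(simplex_bound _) facet_point_excess.
by rewrite setTI setTD !subnn !muln0 mul0r.
Qed.

End AssociahedronPoints.

(** * Transfer of tightness through the normal fan *)

Section Fan.

Variables (R : realType) (n : nat) (D : {set 'I_n}).
Implicit Types (I S T : {set 'I_n}) (x y g : 'rV[R]_n) (P Q : set 'rV[R]_n).

Lemma exists_minimizer (X : Type) (G : X -> Prop) (f : X -> nat) :
  (exists a, G a) -> exists2 a, G a & forall b, G b -> (f a <= f b)%N.
Proof.
move=> [a0 Ga0]; have ex : exists k, `[< exists2 a, G a & f a = k >].
  by exists (f a0); apply/asboolP; exists a0.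
case: (ex_minnP ex) => k /asboolP[a Ga <-] kmin; exists a => // b Gb.
by apply: kmin; apply/asboolP; exists b.
Qed.

Lemma exists_lower_bound (X : finType) (p : pred X) (f : X -> R) :
  (forall t, p t -> 0 < f t) -> exists2 e, 0 < e & forall t, p t -> e <= f t.
Proof.
(* Starting the minimum at 1 keeps it positive when no index satisfies [p]. *)
move=> fpos; exists (\big[Num.min/1]_(t | p t) f t); last first.
  by move=> t pt; exact: bigmin_le_cond.
exact: lt_bigmin ltr01 fpos.
Qed.

(** Faces are sets of maximisers, so minimising the sum over [S] calls for the negated indicator. *)
Definition inner_normal S : 'rV[R]_n := \row_i - (i \in S)%:R.

Lemma dot_inner_normal S x : dot (inner_normal S) x = - coord_sum S x.
Proof.
rewrite /dot /coord_sum sum_mem -sumrN; apply: eq_bigr => i _.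
by rewrite mxE mulNr mulrC.
Qed.

Lemma argmax_inner_normal S P x :
  argmax (inner_normal S) P x <-> P x /\ forall y, P y ->
    coord_sum S x <= coord_sum S y.
Proof.
by split=> -[Px xmin]; split=> // y /xmin; rewrite !dot_inner_normal lerN2.
Qed.

(** This is how equality of fans is used: each nonempty face of [Q] has a partner in [P] along which
    the same linear forms are maximal. *)
Lemma normal_fan_face P Q c x : normal_fan P = normal_fan Q -> argmax c Q x ->
  exists2 G, nonempty_face P G & normal_cone P G = normal_cone Q (argmax c Q).
Proof.
move=> fanE xc; have : normal_fan P (normal_cone Q (argmax c Q)).
  by rewrite fanE; exists (argmax c Q) => //; split; [exists x | exists c].
by case=> G faceG ->; exists G.
Qed.

Lemma associahedron_min S x :
  (forall y, associahedron D y -> coord_sum S x <= coord_sum S y) ->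
  coord_sum S x <= simplex_bound R S.
Proof.
move=> /(_ _ (facet_point_associahedron R D S)).
by rewrite facet_point_tight.
Qed.

Variable tz : {set 'I_n} -> R.
Let P := diagonal_polyhedron D tz.

Definition transfer (e : R) (i j : 'I_n) x : 'rV[R]_n :=
  \row_k (x 0 k + e * ((k == j)%:R - (k == i)%:R)).

Lemma coord_sum_transfer e i j S x :
  coord_sum S (transfer e i j x) = coord_sum S x + e * ((j \in S)%:R - (i \in S)%:R).
Proof.
have sum_delta k : \sum_(t in S) (t == k)%:R = (k \in S)%:R :> R.
  rewrite (sum_mem S) (bigD1 k) //= eqxx mul1r big1 ?addr0 // => t /negPf->.
  by rewrite mul0r.
rewrite /coord_sum (eq_bigr (fun k => x 0 k + e * ((k == j)%:R - (k == i)%:R))).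
  by rewrite big_split /= -mulr_sumr sumrB !sum_delta.
by move=> k _; rewrite mxE.
Qed.

Lemma coord_sum_midpoint S x y :
  coord_sum S (2^-1 *: (x + y)) = (coord_sum S x + coord_sum S y) / 2.
Proof.
rewrite /coord_sum -big_split mulr_suml /=; apply: eq_bigr => i _.
by rewrite !mxE mulrC.
Qed.

Lemma argmax_midpoint c x y : argmax c P x -> argmax c P y ->
  argmax c P (2^-1 *: (x + y)).
Proof.
have dotE : dot c (2^-1 *: (x + y)) = (dot c x + dot c y) / 2.
  rewrite /dot -big_split mulr_suml /=; apply: eq_bigr => i _.
  by rewrite !mxE; field.
move=> [[xT xD] xmax] [[yT yD] ymax]; split; last first.
  by move=> w Pw; rewrite dotE; have := xmax w Pw; have := ymax w Pw; lra.
split; first by rewrite coord_sum_midpoint xT yT; field.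
by move=> delta pd; rewrite coord_sum_midpoint; have := xD _ pd; have := yD _ pd; lra.
Qed.

Hypothesis P_fan : normal_fan P = normal_fan (associahedron D).

(** If no inequality for [S] were tight on the partner [G] of the face of [S], some weight could be
    moved out of [S] without leaving [P], lowering a sum that is minimal on [G]. *)
Lemma facet_attained delta : proper_diagonal D delta ->
  Rset D delta != set0 -> Rset D delta != setT ->
  exists2 g, P g & coord_sum (Rset D delta) g = tz (Rset D delta).
Proof.
set S := Rset D delta => pd S0 ST.
have Sface : argmax (inner_normal S) (associahedron D) (facet_point R S).
  apply/argmax_inner_normal; split; first exact: facet_point_associahedron.
  by move=> y [_ /(_ _ pd)]; rewrite facet_point_tight.
have [G [[g0 Gg0] [c Gc]] NG] := normal_fan_face P_fan Sface.
pose tight x := [set d : 'I_n.+2 * 'I_n.+2 |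
  proper_diagonal D d && (coord_sum (Rset D d) x == tz (Rset D d))].
(* A point of [G] with fewest tight inequalities acts as a relative interior point: what is tight
   there is tight on all of [G]. *)
have [g Gg gmin] := exists_minimizer (fun x => #|tight x|) (ex_intro G g0 Gg0).
have Pg : P g by move: Gg; rewrite Gc => -[].
have tightG d : d \in tight g -> forall y, G y ->
  coord_sum (Rset D d) y = tz (Rset D d).
  move=> dg y Gy; apply/eqP; apply: contraT => dy.
  (* The midpoint is tight only where [g] and [y] both are, so it would lose [d] and contradict
     minimality. *)
  have Gm : G (2^-1 *: (g + y)).
    by move: Gg Gy; rewrite Gc; exact: argmax_midpoint.
  have := gmin _ Gm; rewrite leqNgt => /negP[].
  apply: proper_card; apply/properP; split.
    apply/subsetP=> d'; rewrite !inE coord_sum_midpoint => /andP[pd' /eqP avg].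
    have Py : P y by move: Gy; rewrite Gc => -[].
    rewrite pd'; apply/eqP; have := Py.2 _ pd'; have := Pg.2 _ pd'; lra.
  exists d => //; move: dg dy; rewrite !inE coord_sum_midpoint => /andP[-> /eqP->] /=.
  by apply: contraNneq => E; apply/eqP; lra.
have [/existsP[d /andP[dg /eqP dS]]|/existsPn noS] :=
    boolP [exists d, (d \in tight g) && (Rset D d == S)].
  by exists g => //; rewrite -dS; apply: tightG Gg.
(* The normal of a tight inequality lies in the cone of [G], hence in that of the face of [S]. So
   [facet_point] minimises it too, and [facet_point_tightP] leaves only the trivial sets. *)
have trivial_tight d : d \in tight g -> Rset D d = set0 \/ Rset D d = setT.
  move=> dg; have : normal_cone P G (inner_normal (Rset D d)).
    move=> y Gy; apply/argmax_inner_normal.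
    have Py : P y by move: Gy; rewrite Gc => -[].
    split=> // w [_ Pw]; rewrite (tightG _ dg) //; apply: Pw.
    by move: dg; rewrite inE => /andP[].
  rewrite NG => /(_ _ Sface) /argmax_inner_normal[_ fmin].
  have le : coord_sum (Rset D d) (facet_point R S) <= simplex_bound R (Rset D d).
    exact: associahedron_min fmin.
  have /facet_point_tightP[dE|dE|dE] :
    coord_sum (Rset D d) (facet_point R S) = simplex_bound R (Rset D d).
  - by apply/eqP; rewrite eq_le le facet_point_ge.
  - by left.
  - by have := noS d; rewrite dg dE eqxx.
  - by right.
have [i iS] := set0Pn _ S0.
have [j jS] : exists j, j \notin S.
  by apply/existsP; rewrite -negb_forall; apply: contra ST => /forallP ST;
    apply/eqP/setP=> j; rewrite ST inE.
(* [e] is a lower bound for all positive slacks; moving [e] from [i] to [j] lowers any sum by at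
   most [e] and leaves the trivial tight sums unchanged. *)
have [e e0 emin] : exists2 e, 0 < e & forall d, (d \notin tight g) &&
  proper_diagonal D d ->
    e <= coord_sum (Rset D d) g - tz (Rset D d).
  apply: (@exists_lower_bound ('I_n.+2 * 'I_n.+2)%type) => d /andP[].
  rewrite inE => + pd'; rewrite pd' /= => ne; rewrite subr_gt0 lt_def ne.
  by case: Pg => _; apply.
have Pe : P (transfer e i j g).
  case: Pg => gT gD; split;
    first by rewrite coord_sum_transfer !inE subrr mulr0 addr0.
  move=> d pd'; rewrite coord_sum_transfer.
  have [dg|dg] := boolP (d \in tight g).
    have -> : (j \in Rset D d) = (i \in Rset D d).
      by case: (trivial_tight _ dg) => ->; rewrite !inE.
    by rewrite subrr mulr0 addr0; apply: gD.
  have := emin d; rewrite dg pd' => /(_ isT).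
  by case: (j \in Rset D d); case: (i \in Rset D d);
    rewrite /= ?subrr ?subr0 ?sub0r; lra.
have : normal_cone P G (inner_normal S) by rewrite NG.
move=> /(_ _ Gg) /argmax_inner_normal[_ /(_ _ Pe)].
by rewrite coord_sum_transfer iS (negPf jS) sub0r mulrN1; lra.
Qed.

(** The normals of all [ds] lie in the cone of the face minimising the sum over [I]. On its partner
    in [P] each of these sums is therefore minimal, and by [facet_attained] the minimum is the facet
    bound. *)
Lemma minimum_attained I (ds : seq (polygon_diagonal n)) v : associahedron D v ->
    (forall y, associahedron D y -> coord_sum I v <= coord_sum I y) ->
    (forall y, associahedron D y -> coord_sum I y = coord_sum I v ->
      {in ds, forall d, coord_sum (Rset D d) y = simplex_bound R (Rset D d)}) ->
    {in ds, forall d, [/\ proper_diagonal D d, Rset D d != set0 & Rset D d !=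
      setT]} ->
  exists2 g, P g & {in ds, forall d, coord_sum (Rset D d) g = tz (Rset D d)}.
Proof.
move=> Av vmin dtight dproper.
have Iface : argmax (inner_normal I) (associahedron D) v by apply/argmax_inner_normal.
have [G [[g Gg] [c Gc]] NG] := normal_fan_face P_fan Iface.
have Pg : P g by move: Gg; rewrite Gc => -[].
exists g => // d dds; have [pd S0 ST] := dproper _ dds.
have [f Pf ftight] := facet_attained pd S0 ST.
have : normal_cone P G (inner_normal (Rset D d)).
  rewrite NG => y /argmax_inner_normal[Ay ymin]; apply/argmax_inner_normal;
    split=> // w [_ Aw].
  rewrite (dtight y) //; first exact: Aw.
  by apply/eqP; rewrite eq_le ymin // vmin.
move=> /(_ _ Gg) /argmax_inner_normal[_ /(_ _ Pf)]; rewrite ftight => le.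
by apply/eqP; rewrite eq_le le; case: Pg => _ ->.
Qed.

End Fan.

(** * Ordered lists and cyclic successors *)

Section Lists.

Lemma pairwise_rev (T : Type) (r : rel T) s :
  pairwise r (rev s) = pairwise (fun x y => r y x) s.
Proof.
by elim: s => // x s IH; rewrite rev_cons pairwise_rcons all_rev IH pairwise_cons.
Qed.

Lemma pairwise_enum m (A : {pred 'I_m}) : pairwise (fun i j :
  'I_m => (i < j)%N) (enum A).
Proof.
have -> : enum A = filter (mem A) (enum 'I_m) by rewrite [in RHS]enumT.
apply: pairwise_filter.
have := iota_ltn_sorted 0 m; rewrite -val_enum_ord (sorted_pairwise ltn_trans).
by rewrite pairwise_map.
Qed.

Lemma pairwise_allpairs (T : eqType) (r : rel T) (s t : seq T) :
  pairwise r s -> pairwise r t ->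
  pairwise (fun p q => r p.1 q.1 || r p.2 q.2) [seq (x, y) | x <- s, y <- t].
Proof.
move=> + rt; elim: s => //= x s IH /andP[xs rs].
rewrite pairwise_cat IH // andbT; apply/andP; split; last first.
  by rewrite pairwise_map; apply: sub_pairwise rt => y z /= ->; rewrite orbT.
apply/allrelP=> _ _ /mapP[y _ ->] /allpairsP[[x' y'] [/= xs' _ ->]] /=.
by rewrite (allP xs).
Qed.

(** The second alternative is the wrap-around from the last entry to the first. *)
Lemma next_split (T : eqType) (p : seq T) x : x \in p ->
  (exists p1 p2, p = p1 ++ x :: next p x :: p2) \/
  (exists p', p = next p x :: p' /\ last (next p x) p' = x).
Proof.
move=> xp; rewrite next_nth xp; case: p xp => // y p xp.
have ip : (index x (y :: p) < size (y :: p))%N by rewrite index_mem.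
have [lt_ip|ge_ip] := ltnP (index x (y :: p)) (size p); [left|right].
  exists (take (index x (y :: p)) (y :: p)), (drop (index x (y :: p)).+2 (y :: p)).
  by rewrite -{1}(cat_take_drop (index x (y :: p)) (y :: p)) (drop_nth y) //
    nth_index // (drop_nth y).
exists p; rewrite nth_default //; split=> //.
have ipE : index x (y :: p) = size p by apply/eqP; rewrite eqn_leq ge_ip andbT -ltnS.
by rewrite -[RHS](nth_index y xp) ipE -[size p]/((size (y :: p)).-1) nth_last.
Qed.

End Lists.

(** * Boundary edges of the polygon *)

Section Adjacency.

Variables (n : nat) (D : {set 'I_n}).
Implicit Types (i j : 'I_n) (u v w x y z : 'I_n.+2).

(** The order in which [polygon] lists the labels: [Dbar D] increasing, then U decreasing. *)
Definition polygon_lt x y :=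
  if x \in Dbar D then (y \in Dbar D) ==> (x < y)%N
  else (y \notin Dbar D) && (y < x)%N.

Lemma mem_polygon x : x \in polygon D.
Proof.
rewrite mem_cat in_cons [x \in ord_max :: _]in_cons mem_rev.
case: (labelP x) => [->|->|i ->]; rewrite ?eqxx ?orbT //.
rewrite !(mem_map (@vtx_inj n)) !mem_enum inE.
by case: (i \in D); rewrite !orbT.
Qed.

Lemma pairwise_polygon : pairwise polygon_lt (polygon D).
Proof.
have lt_enum (A : {set 'I_n}) := pairwise_enum (mem A).
rewrite pairwise_cat !pairwise_cons pairwise_rev !pairwise_map; apply/and3P; split.
- apply/allrelP=> x y; rewrite !in_cons mem_rev => xD yU.
  have xD' : x \in Dbar D.
    by case/orP: xD => [/eqP->|/mapP[d + ->]];
      rewrite ?ord0_Dbar // mem_enum vtx_Dbar.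
  rewrite /polygon_lt xD'; case/orP: yU => [/eqP->|/mapP[u + ->]].
    rewrite ord_max_Dbar /=; case/orP: xD => [/eqP->//|/mapP[d _ ->]].
    by rewrite vtxE ltnS.
  by rewrite mem_enum inE vtx_Dbar => /negPf->.
- apply/andP; split.
    apply/allP=> x /mapP[d _ ->]; rewrite /polygon_lt ord0_Dbar.
    by rewrite vtxE implybT.
  have : all (mem D) (enum D) by apply/allP=> d; rewrite mem_enum.
  move=> /sub_in_pairwise; apply; last exact: lt_enum.
  move=> d e dD eD /= de; rewrite /polygon_lt !vtx_Dbar dD eD /=.
  by rewrite ltnS.
- apply/andP; split.
    rewrite all_rev; apply/allP=> x /mapP[u]; rewrite mem_enum inE => uD ->.
    by rewrite /polygon_lt ord_max_Dbar vtx_Dbar (negPf uD).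
  have : all (mem (~: D)) (enum (~: D)) by apply/allP=> d; rewrite mem_enum.
  move=> /sub_in_pairwise; apply; last exact: lt_enum.
  move=> d e; rewrite !inE => dD eD /= de;
    rewrite /polygon_lt !vtx_Dbar (negPf eD) dD /=.
  by rewrite ltnS.
Qed.

Lemma next_polygon x y : next (polygon D) x = y ->
  (forall z, [\/ z = x, z = y, polygon_lt z x && polygon_lt z y
                | polygon_lt x z && polygon_lt y z]) /\ polygon_lt x y \/
  (forall z, (z = x \/ polygon_lt z x) /\ (z = y \/ polygon_lt y z)).
Proof.
move=> xy; have := pairwise_polygon; have := next_split (mem_polygon x); rewrite xy.
case=> [[p1 [p2 pE]]|[p [pE px]]] pw; rewrite pE in pw; [left|right].
  move: pw; rewrite pairwise_cat !pairwise_cons /= => /and3P[p12 _].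
  case/and3P => /andP[xy' xp2] yp2 _; split=> // z.
  have := mem_polygon z; rewrite pE mem_cat !in_cons.
  case/or4P=> [zp1|/eqP->|/eqP->|zp2];
    [apply: Or43|apply: Or41|apply: Or42|apply: Or44] => //.
    by move/allrelP: p12 => p12; rewrite !p12 ?inE ?eqxx ?orbT.
  by rewrite (allP xp2) ?(allP yp2).
move=> z; have := mem_polygon z; rewrite pE => zp; split.
  move: pw zp; rewrite lastI px pairwise_rcons mem_rcons inE => /andP[px' _].
  by case/orP=> [/eqP->|/(allP px')]; [left | right].
move: pw zp; rewrite pairwise_cons inE => /andP[yp _].
by case/orP=> [/eqP->|/(allP yp)]; [left | right].
Qed.

Lemma next_polygonE x y : next (polygon D) x = y ->
  (forall z, [|| z == x :> nat, z == y :> nat, polygon_lt z x && polygon_lt z y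
                | polygon_lt x z && polygon_lt y z]) /\ polygon_lt x y \/
  (forall z, ((z == x :> nat) || polygon_lt z x) && ((z == y :> nat) || polygon_lt
    y z)).
Proof.
move=> /next_polygon[[H xy]|H]; [left; split=> // z|right=> z].
  by case: (H z) => ->; rewrite ?eqxx ?orbT.
by have [[->|->] [->|->]] := H z; rewrite ?eqxx ?orbT.
Qed.

Lemma label_bounds x : x \notin Dbar D -> (0 < x < n.+1)%N.
Proof.
case: (labelP x) => [->|->|i ->]; rewrite ?ord0_Dbar ?ord_max_Dbar // => _.
by rewrite vtxE /= ltnS.
Qed.

Lemma vtx_Dbar_eq i x : i.+1 == x -> (i \in D) = (x \in Dbar D).
Proof. by rewrite -vtxE => /eqP/val_inj <-; rewrite vtx_Dbar. Qed.

Lemma adjacent_Rset x y : (x < y)%N -> adjacent D x y ->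
  Rset D (x, y) = set0 \/ Rset D (x, y) = setT.
Proof.
move=> xy adj; suff : (forall i, i \notin Rset D (x, y)) \/ (forall i, i \in Rset D
  (x, y)).
  by case=> H; [left|right]; apply/setP=> i; rewrite [RHS]inE; [apply/negbTE|];
    exact: H.
have xB := @label_bounds x; have yB := @label_bounds y; have yM := ltn_ord y.
have xE i := @vtx_Dbar_eq i x; have yE i := @vtx_Dbar_eq i y.
(* In order: [y] follows [x], a lower edge; [y] is 0, excluded by [x < y]; [x] follows [y], an upper
   edge; [x] is 0 and [y] the last entry, the closing edge, for which R_delta is [n]. *)
case/orP: adj => /eqP /next_polygonE [[H lt_adj]|H].
- left=> i; have := H ord_max; have := H (vtx i); move: (xE i) (yE i) lt_adj xB yB.
  rewrite in_Rset /polygon_lt ord_max_Dbar vtx_Dbar vtxE /=; clear -xy yM.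
  by case: (i \in D); case: (x \in Dbar D); case: (y \in Dbar D) => //=; lia.
- have := H ord0; move: xB yB; rewrite /polygon_lt ord0_Dbar /=; clear -xy.
  by case: (x \in Dbar D); case: (y \in Dbar D) => //=; lia.
- right=> i; have := H ord_max; have := H (vtx i); move: (xE i) (yE i) lt_adj xB yB.
  have := ltn_ord i.
  rewrite in_Rset /polygon_lt ord_max_Dbar vtx_Dbar vtxE /=; clear -xy yM.
  by case: (i \in D); case: (x \in Dbar D); case: (y \in Dbar D) => //=; lia.
- right=> i; have := H ord_max; have := H ord0; have := H (vtx i).
  move: (xE i) (yE i) xB yB; have := ltn_ord i.
  rewrite in_Rset /polygon_lt ord0_Dbar ord_max_Dbar vtx_Dbar vtxE /=; clear -xy yM.
  by case: (i \in D); case: (x \in Dbar D); case: (y \in Dbar D) => //=; lia.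
Qed.

Lemma proper_diagonal_Rset x y : (x < y)%N -> Rset D (x, y) != set0 ->
  Rset D (x, y) != setT -> proper_diagonal D (x, y).
Proof.
move=> xy R0 RT; rewrite /proper_diagonal xy; apply/negP=> /(adjacent_Rset xy).
by case=> /eqP; [apply/negP | apply/negP].
Qed.

End Adjacency.

(** * Gaps of increasing lists *)

Section ConsecutivePairs.

Variable m : nat.
Implicit Types (s : seq 'I_m) (x t : 'I_m).

Let ltI := fun x y : 'I_m => (x < y)%N.

Lemma zip_beheadP s p : pairwise ltI s -> p \in zip s (behead s) ->
  [/\ p.1 \in s, p.2 \in s, (p.1 < p.2)%N
    & forall t, t \in s -> (t <= p.1)%N \/ (p.2 <= t)%N].
Proof.
elim: s => [//|x [//|y s] IH] xys; rewrite [zip _ _]/= in_cons.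
have /andP[/allP xy ys] := xys; case/orP=> [/eqP->|/(IH ys)[p1 p2 lt_p pt]].
  rewrite /= !inE !eqxx orbT; split=> //; first by apply: xy; rewrite inE eqxx.
  move=> t; rewrite in_cons => /orP[/eqP->|ts]; [by left | right].
  move: ts; rewrite inE => /orP[/eqP->//|ts].
  by case/andP: ys => /allP /(_ _ ts) /ltnW.
split; rewrite ?[_ \in x :: _]in_cons ?p1 ?p2 ?orbT // => t.
rewrite in_cons => /orP[/eqP->|/pt//]; left; exact/ltnW/xy.
Qed.

(** The open gaps are disjoint and cover everything between the first and the last entry except the
    entries themselves. *)
Lemma sum_zip_behead x s t : pairwise ltI (x :: s) -> t \notin x :: s -> (x < t)%N ->
  (\sum_(p <- zip (x :: s) s) (p.1 < t < p.2) = (t < last x s))%N.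
Proof.
elim: s x => [|y s IH] x xys ts xt; first by rewrite big_nil ltnNge (ltnW xt).
rewrite [zip _ _]/= big_cons /= xt /=.
have /andP[/allP xy ys] := xys; move: ts; rewrite in_cons negb_or => /andP[_ ts].
have [ty|yt] := ltnP t y.
  have -> : (t < last y s)%N.
    case/andP: ys => /allP ys _; have := mem_last y s; rewrite inE.
    by case/orP=> [/eqP->//|/ys]; exact: ltn_trans.
  rewrite big1_seq // => p /andP[_ ps].
  have [|p1 _ _ _] := zip_beheadP (s := y :: s) ys (p := p); first exact: ps.
  apply/eqP; rewrite eqb0 negb_and -leqNgt; apply/orP; left.
  move: p1; rewrite inE => /orP[/eqP->|p1]; first exact: ltnW.
  by case/andP: ys => /allP /(_ _ p1) /(ltn_trans ty) /ltnW.
rewrite add0n IH // ltn_neqAle yt andbT.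
by apply: contraNneq ts => /val_inj->; rewrite inE eqxx.
Qed.

End ConsecutivePairs.

(** * Nested components and their maximal intervals *)

Section Components.

Variables (n : nat) (D : {set 'I_n}).
Implicit Types (i j : 'I_n) (u v w x y z : 'I_n.+2) (I J : {set 'I_n}).

Lemma componentsP I ab : ab \in components D I ->
  [/\ ab.1 \in Dbar D :\: @vtx n @: I, ab.2 \in Dbar D :\: @vtx n @: I,
      (ab.1 < ab.2)%N, component I ab != set0
    & forall i, i \in D -> i \notin I -> (ab.1 < vtx i < ab.2)%N = false].
Proof.
rewrite /components mem_filter => /andP[I0 /(zip_beheadP (pairwise_enum _))].
case; rewrite !mem_enum => a b lt_ab H; split=> // i iD iI.
have := H (vtx i); rewrite mem_enum in_setD mem_vtx iI vtx_Dbar iD => /(_ isT).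
by clear -lt_ab; lia.
Qed.

(** The labels of [Dbar D] outside [I] start at 0 and end at n+1, so [i] lies in exactly one gap,
    which is kept because its component contains [i]. *)
Lemma components_cover I i : i \in I ->
  (\sum_(ab <- components D I) (i \in component I ab) = 1)%N.
Proof.
move=> iI; rewrite /components big_filter big_mkcond /=.
have mE ab : (i \in component I ab) = (ab.1 < vtx i < ab.2)%N by rewrite inE iI.
rewrite (eq_bigr (fun ab : 'I_n.+2 * 'I_n.+2 => (ab.1 < vtx i < ab.2)%N : nat));
  last first.
  move=> ab _; rewrite -mE; case: ifP => // /negbFE /eqP->.
  by rewrite inE.
have e0 : ord0 \in enum (Dbar D :\: @vtx n @: I).
  by rewrite mem_enum in_setD ord0_Dbar ord0_vtx.
have e1 : ord_max \in enum (Dbar D :\: @vtx n @: I).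
  by rewrite mem_enum in_setD ord_max_Dbar ord_max_vtx.
have ei : vtx i \notin enum (Dbar D :\: @vtx n @: I).
  by rewrite mem_enum in_setD mem_vtx iI.
have := pairwise_enum (mem (Dbar D :\: @vtx n @: I)).
case: (enum _) e0 e1 ei => // x s e0 e1 ei xs.
rewrite sum_zip_behead //.
  have -> : last x s = ord_max.
    move: e1 xs; rewrite lastI pairwise_rcons mem_rcons inE => /orP[/eqP<-//|e1].
    by case/andP=> /allP /(_ _ e1); rewrite ltnNge -ltnS ltn_ord.
  by rewrite /= ltnS ltn_ord.
move: e0 xs; rewrite inE => /orP[/eqP<-//|e0].
by rewrite pairwise_cons => /andP[/allP /(_ _ e0)].
Qed.

Lemma coord_sum_components (R : realType) I (x : 'rV[R]_n) :
  coord_sum I x = \sum_(ab <- components D I) coord_sum (component I ab) x.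
Proof.
have sumE J : coord_sum J x = \sum_i x 0 i * (i \in J)%:R by exact: sum_mem.
rewrite sumE; under [RHS]eq_bigr => ab _ do rewrite sumE.
rewrite exchange_big; apply: eq_bigr => i _; rewrite -mulr_sumr; congr (_ * _).
have [iI|iI] := boolP (i \in I); first by rewrite -natr_sum components_cover.
by rewrite big1 // => ab _; rewrite inE (negPf iI).
Qed.

Lemma Uint_subset_sub a b a' b' : a \in ~: D -> b \in ~: D -> (a <= b)%N ->
  Uint D a b \subset Uint D a' b' -> (a' <= a)%N /\ (b <= b')%N.
Proof.
move=> aU bU ab sub.
have := subsetP sub a;
  rewrite !inE leqnn ab -in_setC aU => /(_ isT) /andP[_ /andP[-> _]].
by have := subsetP sub b;
  rewrite !inE leqnn ab -in_setC bU => /(_ isT) /andP[_ /andP[_ ->]].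
Qed.

Lemma max_UintsP J p : p \in max_Uints D J ->
  [/\ p.1 \in ~: D, p.2 \in ~: D, (p.1 <= p.2)%N, Uint D p.1 p.2 \subset J
    & forall S, is_Uint D S -> S \subset J -> Uint D p.1 p.2 \subset S ->
      S = Uint D p.1 p.2].
Proof.
case: p => a b; rewrite mem_filter =>
  /andP[/andP[/= le_p /maxsetP[/andP[/= _ pJ] pmax]]].
case/allpairsP=> -[a' b'] /= [aU bU [aE bE]].
move: aU bU; rewrite !mem_enum -aE -bE => aU bU; split=> // S SU SJ pS.
by have := pmax S; rewrite /= SU SJ => /(_ isT pS).
Qed.

Lemma max_Uints_cover J i : i \notin D -> i \in J ->
  exists2 p, p \in max_Uints D J & i \in Uint D p.1 p.2.
Proof.
move=> iD iJ; have [|S Smax iS] :=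
  @maxset_exists _ [pred S | is_Uint D S & S \subset J] (Uint D i i).
  apply/andP; split.
    by apply/existsP; exists i; rewrite inE iD; apply/existsP; exists i;
      rewrite inE iD leqnn eqxx.
  by apply/subsetP=> j; rewrite !inE => /andP[_ ij];
    have /eqP/val_inj-> : (j : nat) == i by lia.
have /andP[/exists_inP[a aU /exists_inP[b bU /andP[ab /eqP SE]]] _] := maxsetp Smax.
exists (a, b); last first.
  by rewrite /= -SE (subsetP iS) // !inE iD leqnn.
rewrite mem_filter /= ab -SE Smax; apply/allpairsP; exists (a, b).
by rewrite !mem_enum.
Qed.

(** The pairs are listed lexicographically, and two overlapping maximal intervals would merge into a
    larger one. *)
Lemma pairwise_max_Uints J : pairwise (fun p q :
  'I_n * 'I_n => (p.2 < q.1)%N) (max_Uints D J).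
Proof.
have lex := pairwise_allpairs (pairwise_enum (mem (~: D))) (pairwise_enum (mem (~:
  D))).
have sJ : all (mem (max_Uints D J)) (max_Uints D J) by exact/allP.
have {}lex : pairwise (fun p q :
  'I_n * 'I_n => (p.1 < q.1)%N || (p.2 < q.2)%N) (max_Uints D J).
  exact: pairwise_filter lex.
move: lex; apply: (sub_in_pairwise _ sJ) => p q pJ qJ /= pq.
have [p1 p2 lep subp maxp] := max_UintsP pJ.
have [q1 q2 leq subq maxq] := max_UintsP qJ.
have isU a b : a \in ~: D -> b \in ~: D -> (a <= b)%N -> is_Uint D (Uint D a b).
  move=> aU bU ab; apply/exists_inP; exists a => //; apply/exists_inP; exists b => //.
  by rewrite ab eqxx.
rewrite ltnNge; apply/negP=> q1p2; have [lt1|le1] := ltnP p.1 q.1.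
  (* The union of the two intervals is [Uint D p.1 b], which starts before [q.1] and contradicts the
     maximality of [q]. *)
  pose b := if (p.2 <= q.2)%N then q.2 else p.2.
  have bU : b \in ~: D by rewrite /b; case: ifP.
  have [pb qb] : (p.2 <= b)%N /\ (q.2 <= b)%N by rewrite /b;
    have [h|/ltnW h] := leqP p.2 q.2; split; rewrite ?leqnn ?h.
  have p1b := leq_trans lep pb.
  have subJ : Uint D p.1 b \subset J.
    apply/subsetP=> i; rewrite inE => /and3P[iU pi ib].
    have [ip|pi'] := leqP i p.2; first by apply: (subsetP subp); rewrite inE iU pi.
    apply: (subsetP subq); rewrite inE iU (leq_trans q1p2 (ltnW pi')) /=.
    move: ib; rewrite /b; case: ifP => // _ ip; by rewrite ltnNge ip in pi'.
  have : Uint D p.1 b \subset Uint D q.1 q.2.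
    rewrite (maxq _ (isU _ _ p1 bU p1b) subJ) //.
    by apply/subsetP=> i; rewrite !inE => /and3P[-> qi iq];
      rewrite (leq_trans (ltnW lt1) qi) (leq_trans iq).
  by case/(Uint_subset_sub p1 bU p1b); rewrite leqNgt lt1.
(* Now the interval of [p] lies properly inside that of [q], against the maximality of [p]. *)
have lt2 : (p.2 < q.2)%N by case/orP: pq => //; rewrite ltnNge le1.
have : Uint D q.1 q.2 \subset Uint D p.1 p.2.
  rewrite (maxp _ (isU _ _ q1 q2 leq) subq) //.
  by apply/subsetP=> i; rewrite !inE => /and3P[-> pi ip];
    rewrite (leq_trans le1 pi) (leq_trans ip) // ltnW.
by case/(Uint_subset_sub q1 q2 leq) => _; rewrite leqNgt lt2.
Qed.

(* As indicators, R_{l,a} + R_{b,r} = R_{l,r} + [n] + [a,b]_U. *)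
Lemma Rset_interval (l r : 'I_n.+2) a b i : a \in ~: D -> b \in ~: D ->
    (l < vtx a)%N -> (a <= b)%N -> (vtx b < r)%N ->
  ((i \in Rset D (l, vtx a)) + (i \in Rset D (vtx b, r)) =
   (i \in Rset D (l, r)) + (i \in Uint D a b).+1)%N.
Proof.
rewrite [_ \in Uint _ _ _]inE !in_setC !in_Rset !vtx_Dbar !vtxE =>
  /negPf-> /negPf-> la ab br.
by case: (i \in D); case: (l \in Dbar D); case: (r \in Dbar D); lia.
Qed.

(** [assoc_diagonals] with free ends and a free list of intervals, so that an induction can move the
    left end past the first interval. *)
Definition chain_diagonals (l r : 'I_n.+2) (s : seq ('I_n * 'I_n)) :
  seq (polygon_diagonal n) :=
  zip (l :: [seq vtx p.2 | p <- s]) (rcons [seq vtx p.1 | p <- s] r).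

Lemma chain_diagonals_cons l r p s :
  chain_diagonals l r (p :: s) =
    @cons (polygon_diagonal n) (l, vtx p.1) (chain_diagonals (vtx p.2) r s).
Proof. by []. Qed.

Definition chain_in (l r : 'I_n.+2) (s : seq ('I_n * 'I_n)) : Prop :=
  [/\ pairwise (fun p q : 'I_n * 'I_n => (p.2 < q.1)%N) s, (l < r)%N &
    forall p, p \in s -> [/\ p.1 \in ~: D, p.2 \in ~: D, (l < vtx p.1)%N,
                          (p.1 <= p.2)%N & (vtx p.2 < r)%N]].

Lemma chain_in_cons l r p s : chain_in l r (p :: s) -> chain_in (vtx p.2) r s.
Proof.
case=> /andP[/allP ps ss] _ H; have [_ _ _ _ pr] := H p (mem_head _ _).
split=> // q qs; have [q1 q2 _ q12 qr] := H q (mem_behead (s := p :: s) qs);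
  split=> //.
by rewrite !vtxE ltnS; apply: ps.
Qed.

(** Peeling off the first interval by [Rset_interval] yields its indicator and one copy of [n]; the
    term in [wtype] of z_I removes these copies. *)
Lemma sum_chain_diagonals l r s i : chain_in l r s ->
  (\sum_(d <- chain_diagonals l r s) (i \in Rset D d) =
   size s + ((i \in Rset D (l, r)) + \sum_(p <- s) (i \in Uint D p.1 p.2)))%N.
Proof.
elim: s l => [|p s IH] l ls; first by rewrite big_seq1 big_nil addn0.
rewrite chain_diagonals_cons big_cons (IH _ (chain_in_cons ls)) big_cons.
case: ls => _ _ /(_ p (mem_head _ _)) [p1 p2 lp p12 pr].
by have := Rset_interval i p1 p2 lp p12 pr; rewrite /=; lia.
Qed.

Lemma chain_diagonalsP l r s d : chain_in l r s -> d \in chain_diagonals l r s ->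
  [/\ (d.1 < d.2)%N, (l <= d.1)%N, (d.2 <= r)%N,
    d.1 = l \/ (exists2 p, p \in s & d.1 = vtx p.2) &
    d.2 = r \/ (exists2 p, p \in s & d.2 = vtx p.1)] /\
  forall p, p \in s -> (vtx p.2 <= d.1)%N \/ (d.2 <= vtx p.1)%N.
Proof.
elim: s l => [|p s IH] l ls.
  by rewrite inE => /eqP->; case: ls => _ lr _; do !split=> //; left.
have ls' := chain_in_cons ls; have [/andP[/allP ps _] _ H] := ls.
have [p1 p2 lp p12 pr] := H p (mem_head _ _).
have vp : (vtx p.1 <= vtx p.2)%N by rewrite !vtxE ltnS.
rewrite chain_diagonals_cons in_cons =>
  /orP[/eqP->|/(IH _ ls')[[lt_d ld dr d1 d2] dp]].
  split=> [|q] /=.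
    split=> //; first exact: ltnW (leq_ltn_trans vp pr).
    - by left.
    - by right; exists p; rewrite ?mem_head.
  rewrite in_cons => /orP[/eqP->|/ps pq]; right=> //.
  by rewrite ltnS (leq_trans p12) // ltnW.
split; last first.
  by move=> q; rewrite in_cons => /orP[/eqP->|/dp//]; left.
split=> //.
- exact: leq_trans (leq_trans (ltnW lp) vp) ld.
- by right; case: d1 => [->|[q qs ->]]; [exists p | exists q];
    rewrite // ?mem_head // in_cons qs orbT.
by case: d2 => [->|[q qs ->]]; [left | right; exists q => //;
  rewrite in_cons qs orbT].
Qed.

End Components.

(** * Associated diagonals and the bounds z_I *)

Section AssociatedDiagonals.

Variables (n : nat) (D : {set 'I_n}).
Implicit Types (i j : 'I_n) (I J : {set 'I_n}).

Lemma component_chain I ab : ab \in components D I ->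
  chain_in D ab.1 ab.2 (max_Uints D (component I ab)).
Proof.
case/componentsP=> _ _ lt_ab _ _; split=> //; first exact: pairwise_max_Uints.
move=> p /max_UintsP[p1 p2 lep sub _].
have := subsetP sub p.1; have := subsetP sub p.2.
rewrite ![_ \in Uint _ _ _]inE p1 p2 lep !leqnn => /(_ isT) + /(_ isT).
by rewrite [_ \in component _ _]inE [p.1 \in component _ _]inE =>
  /and3P[_ _ ->] /and3P[_ -> _].
Qed.

Lemma sum_Uint (s : seq ('I_n * 'I_n)) i :
  pairwise (fun p q : 'I_n * 'I_n => (p.2 < q.1)%N) s ->
  (\sum_(p <- s) (i \in Uint D p.1 p.2) = has (fun p => i \in Uint D p.1 p.2) s)%N.
Proof.
elim: s => [|p s IH] /=; first by rewrite big_nil.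
case/andP=> /allP ps /IH; rewrite big_cons => ->.
have [|//] := boolP (i \in Uint D p.1 p.2); rewrite inE => /and3P[_ _ ip].
have /negPf-> // : ~~ has (fun q => i \in Uint D q.1 q.2) s.
apply/hasPn=> q qs; rewrite inE; apply/negP=> /and3P[_ qi _].
by have := ps q qs; rewrite ltnNge (leq_trans qi ip).
Qed.

(** All elements of D between the ends belong to [I] and form the R-set of [ab]; the elements of U
    are covered once by the disjoint maximal intervals. *)
Lemma mem_component I ab i : ab \in components D I ->
  ((i \in Rset D ab) + \sum_(p <- max_Uints D (component I ab)) (i \in Uint D p.1
    p.2) =
   (i \in component I ab))%N.
Proof.
move=> abI; have [/setDP[aD _] /setDP[bD _] _ _ abD] := componentsP abI.
rewrite sum_Uint ?pairwise_max_Uints //.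
have -> : (i \in Rset D ab) = (i \in D) && (ab.1 < i.+1 < ab.2)%N.
  by move: aD bD; case: (ab) => a b /= aD bD; rewrite in_Rset aD bD.
have [iD|iD] := boolP (i \in D).
  have /negPf-> : ~~ has (fun p =>
    i \in Uint D p.1 p.2) (max_Uints D (component I ab)).
    by apply/hasPn=> p _; rewrite !inE iD.
  rewrite addn0 [in RHS]inE /=; have [//|iI] := boolP (i \in I).
  by rewrite -vtxE abD.
rewrite add0n; congr (nat_of_bool _);
  apply/hasP/idP=> [[p /max_UintsP[_ _ _ sub _]]|iJ].
  exact: (subsetP sub).
by have [p] := max_Uints_cover iD iJ; exists p.
Qed.

(** Strictly between the ends of [d], elements of D belong to [I] and are deleted from the path; an
    element of U in [I] would lie in a maximal interval, and none reaches into this gap. *)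
Lemma assoc_diagonals_consecutive I ab d :
    ab \in components D I -> d \in assoc_diagonals D I ab ->
  [/\ (d.1 < d.2)%N, d.1 \in sweep_path D I, nxt (sweep_path D I) d.1 = d.2
    & Rset D d != set0].
Proof.
move=> abI dI; have [/setDP[aD aI] /setDP[bD bI] lt_ab J0 abD] := componentsP abI.
have abch := component_chain abI; have [_ _ ch] := abch.
have [[lt_d ad db d1 d2] dp] := chain_diagonalsP abch dI.
have inI p : p \in max_Uints D (component I ab) -> (p.1 \in I) /\ (p.2 \in I).
  case/max_UintsP=> p1 p2 lep sub _.
  have := subsetP sub p.1; have := subsetP sub p.2.
  rewrite ![_ \in Uint _ _ _]inE p1 p2 lep !leqnn => /(_ isT) + /(_ isT).
  by rewrite [_ \in component _ _]inE [p.1 \in component _ _]inE =>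
    /andP[-> _] /andP[-> _].
have memU p : p \in max_Uints D (component I ab) -> (p.1 \notin D) /\ (p.2 \notin D).
  by case/max_UintsP; rewrite !in_setC.
have d1S : d.1 \in sweep_path D I.
  case: d1 => [->|[p ps ->]]; first by rewrite in_sweep aD (negPf aI).
  by have [_ pI] := inI _ ps; have [_ pD] := memU _ ps;
    rewrite vtx_sweep pI (negPf pD).
have d2S : d.2 \in sweep_path D I.
  case: d2 => [->|[p ps ->]]; first by rewrite in_sweep bD (negPf bI).
  by have [pI _] := inI _ ps; have [pD _] := memU _ ps;
    rewrite vtx_sweep pI (negPf pD).
have between i : (d.1 < vtx i)%N -> (vtx i < d.2)%N -> vtx i \notin sweep_path D I.
  move=> di id; rewrite vtx_sweep negbK.
  have ai : (ab.1 < vtx i < ab.2)%N by rewrite (leq_ltn_trans ad di) (leq_trans id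
    db).
  have [iD|iD] := boolP (i \in D).
    by apply/eqP/esym; apply: contraT => iI; rewrite abD in ai.
  apply/eqP/esym/negbTE/negP => iI.
  have [|p pJ] := @max_Uints_cover n D (component I ab) i iD; first by rewrite inE iI.
  rewrite inE => /and3P[_ pi ip]; case: (dp p pJ).
    by rewrite leqNgt (leq_trans di) // !vtxE ltnS.
  by rewrite leqNgt (leq_ltn_trans _ id) // !vtxE ltnS.
split=> //.
  apply: nxt_eq => //; first exact: ord_max_sweep.
    by apply: contraTneq lt_d => ->; rewrite -leqNgt -ltnS ltn_ord.
  move=> z zS d1z; rewrite leqNgt; apply/negP=> zd2; move: zS d1z zd2.
  case: (labelP z) => [->|->|i -> iS d1i id2]; first by rewrite ltn0.
    by move=> _ _; rewrite ltnNge -ltnS ltn_ord.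
  by move: iS; apply/negP/between.
(* An end in U belongs to the R-set of the diagonal itself. *)
have mem_ends : (exists2 i, i \notin D & d.1 = vtx i) \/ (exists2 i, i \notin D &
  d.2 = vtx i) -> Rset D d != set0.
  case: (d) lt_d => x y /= xy [[i iD E]|[i iD E]]; apply/set0Pn; exists i;
    rewrite in_Rset E vtx_Dbar (negPf iD) vtxE leqnn ?orbT; by case: ifP.
case: d1 => [d1|[p ps d1]]; last by apply: mem_ends; left; exists p.2;
  have [] := memU _ ps.
case: d2 => [d2|[p ps d2]]; last by apply: mem_ends; right; exists p.1;
  have [] := memU _ ps.
(* Here [d] is [ab] itself. The component has an element, which must be in D: a maximal interval
   would separate the ends. *)
have [i iJ] := set0Pn _ J0; apply/set0Pn; exists i.
have -> : d = ab by move: d1 d2; case: (d) (ab) => ? ? [? ?] /= -> ->.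
have [iD|iD] := boolP (i \in D).
  have [aE bE] := (aD, bD); move: iJ; rewrite inE; case: (ab) aE bE => a b /= aE bE.
  by rewrite in_Rset aE bE iD => /andP[].
have [p pJ] := max_Uints_cover iD iJ; have [_ _ ap p12 pb] := ch _ pJ.
have vp : (vtx p.1 <= vtx p.2)%N by rewrite !vtxE ltnS.
case: (dp p pJ); rewrite ?d1 ?d2 leqNgt => /negP[]; first exact: leq_trans ap vp.
exact: leq_ltn_trans vp pb.
Qed.

Definition all_diagonals I :=
  flatten [seq assoc_diagonals D I ab | ab <- components D I].

Lemma all_diagonals_consecutive I d : d \in all_diagonals I ->
  [/\ (d.1 < d.2)%N, d.1 \in sweep_path D I, nxt (sweep_path D I) d.1 = d.2
    & Rset D d != set0].
Proof. by case/flatten_mapP=> ab; exact: assoc_diagonals_consecutive. Qed.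

Variable R : realType.
Implicit Types (x y : 'rV[R]_n) (tz : {set 'I_n} -> R).

Lemma zI_all_diagonals tz I : zI D tz I =
  \sum_(d <- all_diagonals I) tz (Rset D d)
    - (\sum_(ab <- components D I) (wtype D I ab)%:R) * tz setT.
Proof. by rewrite /zI sumrB -mulr_suml big_flatten big_map. Qed.

Lemma coord_sum_zI x I : coord_sum I x = zI D (fun J => coord_sum J x) I.
Proof.
rewrite (coord_sum_components D); apply: eq_big_seq => ab abI.
have sumE J : coord_sum J x = \sum_i x 0 i * (i \in J)%:R by exact: sum_mem.
rewrite sumE; under [X in X - _]eq_bigr => d _ do rewrite sumE.
rewrite exchange_big /= sumE mulr_sumr -sumrB; apply: eq_bigr => i _.
rewrite in_setT mulr1 -mulr_sumr -natr_sum.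
have := sum_chain_diagonals i (component_chain abI).
rewrite -/(assoc_diagonals D I ab) => ->.
have := mem_component i abI; rewrite [ab in Rset D ab]surjective_pairing => ->.
by rewrite natrD /wtype; ring.
Qed.

(** Coordinate sums satisfy the formula for z_I exactly, so the excess is a sum of facet slacks;
    both the lower bound and its equality case follow. *)
Lemma zI_excess tz x I : coord_sum setT x = tz setT ->
  coord_sum I x - zI D tz I =
  \sum_(d <- all_diagonals I) (coord_sum (Rset D d) x - tz (Rset D d)).
Proof.
move=> xT; rewrite coord_sum_zI !zI_all_diagonals xT sumrB.
by rewrite opprB addrA subrK.
Qed.

Lemma all_diagonals_ge tz x I : diagonal_polyhedron D tz x ->
  {in all_diagonals I, forall d, tz (Rset D d) <= coord_sum (Rset D d) x}.
Proof.
case=> xT xD d /all_diagonals_consecutive[lt_d _ _ R0].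
have [->|RT] := eqVneq (Rset D d) setT; first by rewrite xT.
by apply: xD; move: lt_d R0 RT; case: (d) => a b; exact: proper_diagonal_Rset.
Qed.

Lemma zI_le tz x I : diagonal_polyhedron D tz x -> zI D tz I <= coord_sum I x.
Proof.
move=> Px; rewrite -subr_ge0 zI_excess; last by case: Px.
by rewrite big_seq sumr_ge0 // => d dI; rewrite subr_ge0 (all_diagonals_ge Px dI).
Qed.

Lemma zI_eq tz x I : diagonal_polyhedron D tz x ->
  coord_sum I x = zI D tz I <->
  {in all_diagonals I, forall d, coord_sum (Rset D d) x = tz (Rset D d)}.
Proof.
move=> Px; have xT : coord_sum setT x = tz setT by case: Px.
have := zI_excess I xT; split=> [E d dI|tight]; last first.
  apply/eqP; rewrite -subr_eq0 H big_seq big1 // => d dI.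
  by rewrite tight // subrr.
apply/eqP; rewrite -subr_eq0; move: H; rewrite E subrr big_seq => /esym/eqP.
rewrite psumr_eq0 => [/allP /(_ _ dI)|d' d'I]; first by rewrite dI.
by rewrite subr_ge0 (all_diagonals_ge Px d'I).
Qed.

Lemma zI_attained tz I :
    normal_fan (diagonal_polyhedron D tz) = normal_fan (@associahedron R n D) ->
  exists2 g, diagonal_polyhedron D tz g & coord_sum I g = zI D tz I.
Proof.
move=> fanE; have [v Av vtight] := associahedron_sweep_point R D I.
(* The associated diagonals are edges of the path of [I], all tight at the sweep point. *)
have vzI : coord_sum I v = zI D (@simplex_bound R n) I.
  apply/(zI_eq I Av) => d /all_diagonals_consecutive[lt_d dS dnxt _].
  have d1 : d.1 != ord_max by apply: contraTneq lt_d => ->;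
    rewrite -leqNgt -ltnS ltn_ord.
  by have := vtight _ dS d1; rewrite dnxt -surjective_pairing.
(* Diagonals with R_delta = [n] are set aside: their equation holds on the whole polyhedron. *)
have [||d|g Pg gtight] := minimum_attained fanE (I := I)
  (ds := [seq d <- all_diagonals I | Rset D d != setT]) Av.
- by move=> y Ay; rewrite vzI; exact: zI_le.
- move=> y Ay; rewrite vzI => /(zI_eq I Ay) ytight d.
  by rewrite mem_filter => /andP[_]; exact: ytight.
- rewrite mem_filter => /andP[RT /all_diagonals_consecutive[lt_d _ _ R0]].
  split=> //; move: lt_d R0 RT; case: (d) => a b; exact: proper_diagonal_Rset.
exists g => //; apply/(zI_eq I Pg) => d dI.
have [->|RT] := eqVneq (Rset D d) setT; first by case: Pg.
by apply: gtight; rewrite mem_filter RT.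
Qed.

End AssociatedDiagonals.

(** * Description of the polytope by tight inequalities for all subsets *)

Theorem proposition3p8 (R : realType) (n : nat) (n_ge2 : (2 <= n)%N)
  (D : {set 'I_n})
  (D_first : forall i : 'I_n, vtx i = 1%N :> nat -> i \in D)
  (D_last : forall i : 'I_n, vtx i = n :> nat -> i \in D)
  (tz : {set 'I_n} -> R)
  (P_polytope : polytope (diagonal_polyhedron D tz))
  (P_fan : normal_fan (diagonal_polyhedron D tz)
           = normal_fan (associahedron D)) :
  let P := diagonal_polyhedron D tz in
  let z := zI D tz in
  P = [set x : 'rV[R]_n | coord_sum setT x = z setT /\
         forall I : {set 'I_n}, I != set0 -> I \proper setT ->
           z I <= coord_sum I x]%classic
  /\ forall I : {set 'I_n}, I != set0 ->
       is_minimum [set coord_sum I x | x in P]%classic (z I).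
Proof.
move=> P z; have attained I := zI_attained I P_fan.
have zT : z setT = tz setT by have [g [gT _] gE] := attained setT; rewrite /z -gE.
split; last first.
  move=> I _; split; first by have [g Pg gI] := attained I; exists g.
  by move=> _ [x Px <-]; exact: zI_le.
apply/seteqP; split=> x [xT xI]; split; rewrite ?zT // in xT *.
  by move=> I _ _; apply: zI_le.
(* R_delta is itself one of the sets [I]: its bound z is attained at a point of [P], hence is at
   least the facet bound. *)
move=> d pd; have [g Pg gd] := attained (Rset D d).
have gle : tz (Rset D d) <= coord_sum (Rset D d) g by case: Pg => _; apply.
have [RT|RT] := eqVneq (Rset D d) setT; first by rewrite RT xT.
have [R0|R0] := eqVneq (Rset D d) set0.
  by apply: le_trans gle _; rewrite R0 /coord_sum !big_set0.
apply: le_trans gle _; rewrite gd; apply: xI => //.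
by rewrite properT.
Qed.
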